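(* Let $(A,\mathfrak m)$ be a regular local ring and let $M$ be a finitely generated $A$-module. Let $\mathbf u=u_1,\dots,u_m$ be elements of $\mathfrak m$ and set $I=(\mathbf u)$. Assume that $M\otimes_A A/I$ has finite length and that $\dim M+\dim A/I<\dim A$. Then (1) $\chi(\mathbf u,M)=0$; (2) $m>\dim M$.
   Context: $H_i(\mathbf u,M)$ is the $i$-th Koszul homology module of $\mathbf u$ with coefficients in $M$. When $M/IM$ has finite length all $H_i(\mathbf u,M)$ have finite length, and $\chi(\mathbf u,M)=\sum_{i\ge 0}(-1)^i\ell(H_i(\mathbf u,M))$, where $\ell$ denotes length. *)

(* Defs.v *)
From HB Require Import structures.
From mathcomp Require Import all_boot all_order all_algebra generic_quotient.
From mathcomp Require Import boolp classical_sets constructive_ereal.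

Set Implicit Arguments.
Unset Strict Implicit.
Unset Printing Implicit Defensive.

Import Order.TTheory GRing.Theory Num.Theory.

Local Open Scope ring_scope.

(* Submodules are terms of the library type [submodClosed V] (boolean
   predicates, hence by classical logic all submodules).  The ideals of a
   commutative ring are the submodules of its regular module; unlike the
   library's [idealr], they need not be proper. *)
Notation ideal R := (submodClosed R^o).

Section QuotientModule.
Context {R : pzRingType} {V : lmodType R}.
Implicit Type N : submodClosed V.

Definition Submod (S : V -> bool) (closedS : submod_closed S) :
    submodClosed V :=
  HB.pack S (GRing.isSubmodClosed.Build R V S closedS).

(* [submodClosed], being defined over semimodules, does not inherit
   [zmodClosed], on which the library's additive quotient is based. *)
Definition in_submod N : V -> bool := fun x => x \in N.

Fact submod_zmod_closed N : zmod_closed (in_submod N).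
Proof. exact: (submodClosedP N). Qed.

Definition zmod_of N : zmodClosed V :=
  HB.pack (in_submod N)
    (GRing.isZmodClosed.Build V (in_submod N) (submod_zmod_closed N)).

Definition quot N := @Quotient.quot V (zmod_of N).

HB.instance Definition _ N := GRing.Zmodule.on (quot N).
HB.instance Definition _ N : EqQuotient V (Quotient.equiv (zmod_of N)) (quot N) :=
  EqQuotient.on (quot N).

Lemma quot_eqP N (x y : V) :
  reflect (\pi_(quot N) x = \pi_(quot N) y)%qT (x - y \in N).
Proof.
have -> : (x - y \in N) = (x - y \in zmod_of N) by [].
by rewrite Quotient.idealrBE; apply: eqP.
Qed.

Lemma quot_reprK N (x : V) : x - repr (\pi_(quot N) x)%qT \in N.
Proof. by apply/quot_eqP; rewrite reprK. Qed.

Definition quot_scale N (a : R) := lift_op1 (quot N) ( *:%R a).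

Lemma pi_quot_scale N a :
  {morph \pi_(quot N)%qT : x / a *: x >-> quot_scale a x}.
Proof.
move=> x; unlock quot_scale; apply/quot_eqP.
by rewrite -scalerBr rpredZ // quot_reprK.
Qed.
Canonical pi_quot_scale_morph N a := PiMorph1 (@pi_quot_scale N a).

Fact quot_scaleA N a b (x : quot N) :
  quot_scale a (quot_scale b x) = quot_scale (a * b) x.
Proof. by rewrite -[x]reprK !piE scalerA. Qed.

Fact quot_scale1 N : left_id 1 (@quot_scale N).
Proof. by move=> x; rewrite -[x]reprK !piE scale1r. Qed.

Fact quot_scaleDr N : right_distributive (@quot_scale N) +%R.
Proof. by move=> a x y; rewrite -[x]reprK -[y]reprK !piE scalerDr. Qed.

Fact quot_scaleDl N (x : quot N) : {morph (@quot_scale N)^~ x : a b / a + b}.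
Proof. by move=> a b /=; rewrite -[x]reprK !piE scalerDl. Qed.

HB.instance Definition _ N := GRing.Zmodule_isLmodule.Build R (quot N)
  (@quot_scaleA N) (@quot_scale1 N) (@quot_scaleDr N) (@quot_scaleDl N).

End QuotientModule.

Section QuotientRing.
Context {R : comPzRingType}.
Implicit Type J : ideal R.

Definition quot_one J : quot J := lift_cst (quot J) (1 : R).
Definition quot_mul J := lift_op2 (quot J) ( *%R : R -> R -> R).

Canonical pi_quot_one_morph J := PiConst (quot_one J).

Lemma pi_quot_mul J :
  {morph \pi_(quot J)%qT : x y / (x : R) * (y : R) >-> quot_mul x y}.
Proof.
move=> x y; unlock quot_mul; apply/quot_eqP.
set x' := repr _; set y' := repr _.
have -> : x * y - (x' : R) * (y' : R) = (x : R) * (y - y') + y' * (x - x').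
  by rewrite !mulrBr addrA [y' * x]mulrC [y' * x']mulrC subrK.
by rewrite rpredD //; apply: (@rpredZ _ _ J); apply: quot_reprK.
Qed.
Canonical pi_quot_mul_morph J := PiMorph2 (@pi_quot_mul J).

Fact quot_mulA J : associative (@quot_mul J).
Proof.
by move=> x y z; rewrite -[x]reprK -[y]reprK -[z]reprK !piE mulrA.
Qed.

Fact quot_mulC J : commutative (@quot_mul J).
Proof. by move=> x y; rewrite -[x]reprK -[y]reprK !piE mulrC. Qed.

Fact quot_mul1 J : left_id (quot_one J) (@quot_mul J).
Proof. by move=> x; rewrite -[x]reprK !piE mul1r. Qed.

Fact quot_mulDl J : left_distributive (@quot_mul J) +%R.
Proof.
by move=> x y z; rewrite -[x]reprK -[y]reprK -[z]reprK !piE mulrDl.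
Qed.

HB.instance Definition _ J := GRing.Zmodule_isComPzRing.Build (quot J)
  (@quot_mulA J) (@quot_mulC J) (@quot_mul1 J) (@quot_mulDl J).

End QuotientRing.

Section Submodules.
Context {R : pzRingType} {V : lmodType R}.

Definition submod (N : submodClosed V) := {x : V | x \in N}.

HB.instance Definition _ (N : submodClosed V) := SubChoice.on (submod N).
HB.instance Definition _ (N : submodClosed V) :=
  [SubChoice_isSubLmodule of submod N by <:].

Definition in_submod_gen (S : set V) : V -> bool := fun x =>
  `[< exists2 s : seq (R * V), (forall p, p \in s -> S p.2) &
        x = \sum_(p <- s) p.1 *: p.2 >].

Fact submod_gen_closed S : submod_closed (in_submod_gen S).
Proof.
split=> [|a x y /asboolP[s Ss ->] /asboolP[t St ->]]; apply/asboolP.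
  by exists [::]; rewrite ?big_nil.
exists ([seq (a * p.1, p.2) | p <- s] ++ t).
  by move=> p; rewrite mem_cat => /orP[/mapP[q /Ss Sq ->]|/St].
rewrite big_cat big_map scaler_sumr; congr (_ + _).
by apply: eq_bigr => p _; rewrite scalerA.
Qed.

Definition submod_gen S : submodClosed V := Submod (submod_gen_closed S).

(* Z / (B :&: Z), that is, Z / B when B is contained in Z. *)
Definition in_submod_trace (Z B : submodClosed V) : submod Z -> bool :=
  fun z => val z \in B.

Fact submod_trace_closed Z B : submod_closed (in_submod_trace (Z := Z) B).
Proof.
split=> [|a x y]; rewrite unfold_in /in_submod_trace; first by rewrite raddf0 rpred0.
by move=> Bx By; rewrite unfold_in raddfD rpredD ?rpredZ.
Qed.

Definition submod_trace Z B : submodClosed (submod Z) :=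
  Submod (submod_trace_closed Z B).

Definition subquot (Z B : submodClosed V) : lmodType R := quot (submod_trace Z B).

End Submodules.

(* Lengths and dimensions take values in {-oo} + nat + {+oo}; the supremum of
   the empty set is -oo, so that the zero module has dimension -oo. *)
Definition nat_sup (P : set nat) : \bar int :=
  supremum -oo%E [set n%:Z%:E | n in P]%classic.

Section Length.
Context {R : pzRingType} (V : lmodType R).

Definition submod_chain (n : nat) : Prop :=
  exists N : nat -> submodClosed V, forall i, (i < n)%N ->
    {subset N i <= N i.+1} /\ ~ {subset N i.+1 <= N i}.

Definition module_length : \bar int := nat_sup submod_chain.

Definition finite_length : Prop := (module_length < +oo)%E.

Definition finitely_generated : Prop :=
  exists s : seq V, forall x : V, x \in submod_gen [set` s]%classic.

End Length.

Section Dimension.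

Definition prime_ideal {R : comPzRingType} (P : ideal R) : Prop :=
  (1 : R) \notin P /\
  forall a b : R, a * b \in P -> a \in P \/ b \in P.

Definition prime_chain (R : comPzRingType) (n : nat) : Prop :=
  exists P : nat -> ideal R,
    (forall i, (i <= n)%N -> prime_ideal (P i)) /\
    (forall i, (i < n)%N ->
      {subset P i <= P i.+1} /\ ~ {subset P i.+1 <= P i}).

Definition krull_dim (R : comPzRingType) : \bar int := nat_sup (prime_chain R).

Context {R : comPzRingType} (V : lmodType R).

Definition in_ann : R^o -> bool := fun a => `[< forall x : V, (a : R) *: x = 0 >].

Fact ann_submod_closed : submod_closed in_ann.
Proof.
split=> [|a b c /asboolP bV /asboolP cV]; apply/asboolP => x.
  by rewrite scale0r.
by rewrite scalerDl cV addr0 -scalerA bV scaler0.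
Qed.

Definition ann : ideal R := Submod ann_submod_closed.

Definition module_dim : \bar int := krull_dim (quot ann).

End Dimension.

Section RegularLocal.
Context {A : comNzRingType}.
Implicit Types I J mm : ideal A.

Definition ideal_gen (n : nat) (u : 'I_n -> A) : ideal A :=
  submod_gen (range (u : 'I_n -> A^o)).

Definition ideal_smul I (M : lmodType A) : submodClosed M :=
  submod_gen [set y | exists a x, a \in I /\ y = (a : A) *: x]%classic.

Definition maximal_ideal mm : Prop :=
  (1 : A) \notin mm /\
  forall J, (1 : A) \notin J -> {subset mm <= J} -> J =i mm.

Definition local_ring mm : Prop :=
  maximal_ideal mm /\ forall J, maximal_ideal J -> J =i mm.

Definition noetherian_ring : Prop :=
  forall J, exists (n : nat) (x : 'I_n -> A), J =i ideal_gen x.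

Definition regular_local_ring mm : Prop :=
  [/\ local_ring mm, noetherian_ring &
      exists (d : nat) (x : 'I_d -> A),
        krull_dim A = d%:Z%:E /\ mm =i ideal_gen x].

End RegularLocal.

Arguments noetherian_ring A : clear implicits.

Section Koszul.
Context {A : comNzRingType} {m : nat} (u : 'I_m -> A) (M : lmodType A).

(* The family x stands for the sum of the (x S) e_S, where e_S is the exterior
   product of the e_j for j in S, taken in increasing order. *)
Definition koszul : lmodType A := {ffun {set 'I_m} -> M}.

(* d e_S is the sum over j in S of (-1)^#{k in S | k < j} u_j e_(S \ j);
   below is the coefficient at e_T of d x, hence S = j |: T. *)
Definition koszul_d (x : koszul) : koszul :=
  [ffun T : {set 'I_m} => \sum_(j | j \notin T)
     ((-1) ^+ #|[set k in T | (k < j)%N]| * u j) *: x (j |: T)].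

Fact koszul_d_linear : linear koszul_d.
Proof.
move=> a x y; apply/ffunP => T; rewrite !ffunE scaler_sumr -big_split.
apply: eq_bigr => j _; rewrite !ffunE scalerDr.
by rewrite !scalerA [a * _]mulrC.
Qed.

HB.instance Definition _ :=
  GRing.isLinear.Build A koszul koszul *:%R koszul_d koszul_d_linear.

Fact koszul_dd x : koszul_d (koszul_d x) = 0.
Proof.
apply/ffunP => T; rewrite !ffunE.
pose s (j : 'I_m) (S : {set 'I_m}) : A := (-1) ^+ #|[set k in S | (k < j)%N]|.
have sU j k : j \notin T -> s k (j |: T) = (if (j < k)%N then -1 else 1) * s k T.
  move=> jT; rewrite /s; case: ifP => jk.
    have -> : [set k0 in j |: T | (k0 < k)%N] = j |: [set k0 in T | (k0 < k)%N].
      by apply/finset.setP => i; rewrite !inE; case: eqP => [->|].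
    by rewrite cardsU1 !inE (negbTE jT) /= exprD expr1.
  have -> : [set k0 in j |: T | (k0 < k)%N] = [set k0 in T | (k0 < k)%N].
    by apply/finset.setP => i; rewrite !inE; case: eqP => [->|]; rewrite ?jk ?andbF.
  by rewrite mul1r.
pose F j k : M := (s j T * s k T * u j * u k) *: x (j |: (k |: T)).
have FC j k : F j k = F k j.
  rewrite /F finset.setUCA; congr (_ *: _).
  rewrite -!mulrA; rewrite mulrCA; congr (_ * (_ * _)); by rewrite mulrC.
transitivity (\sum_(j | j \notin T) \sum_(k | (k \notin T) && (k != j))
   (if (j < k)%N then - F j k else F j k)).
  apply: eq_bigr => j jT; rewrite ffunE scaler_sumr.
  apply: eq_big => [k|k]; first by rewrite !inE negb_or andbC.
  rewrite !inE negb_or => /andP[kj kT]; rewrite scalerA.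
  rewrite -/(s j T) -/(s k (j |: T)) sU // finset.setUCA.
  rewrite /F; case: ifP => _; rewrite -?scaleNr; congr (_ *: _); last by rewrite mul1r mulrACA mulrA.
  by rewrite !mulN1r mulNr mulrN mulrACA mulrA.
have E j : \sum_(k | (k \notin T) && (k != j)) (if (j < k)%N then - F j k else F j k)
  = - \sum_(k | (k \notin T) && (j < k)%N) F j k + \sum_(k | (k \notin T) && (k < j)%N) F j k.
  rewrite (bigID (fun k : 'I_m => (j < k)%N)) /=; congr (_ + _).
    rewrite -sumrN; apply: eq_big => [k|k /andP[_ ->]] //.
    by rewrite neq_ltn -andbA; case: (ltngtP k j); rewrite ?andbF ?andbT.
  apply: eq_big => [k|k /andP[_ /negbTE ->]] //.
  by rewrite neq_ltn -andbA; case: (ltngtP k j); rewrite ?andbF ?andbT.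
rewrite (eq_bigr _ (fun j _ => E j)) big_split /= sumrN.
apply/eqP; rewrite addrC subr_eq0; apply/eqP.
rewrite (exchange_big_dep (fun k => k \notin T)) //=; last by move=> ? ? ? /andP[].
apply: eq_bigr => k kT; apply: eq_big => [j|j _]; last exact: FC.
by rewrite kT.
Qed.

Definition koszul_deg (i : nat) (x : koszul) : Prop :=
  forall S : {set 'I_m}, #|S| <> i -> x S = 0.

Definition in_cycles (i : nat) : koszul -> bool := fun x =>
  `[< koszul_deg i x /\ koszul_d x = 0 >].

Definition in_boundaries (i : nat) : koszul -> bool := fun x =>
  `[< exists2 y, koszul_deg i.+1 y & x = koszul_d y >].

Fact koszul_deg_closed i a x y :
  koszul_deg i x -> koszul_deg i y -> koszul_deg i (a *: x + y).
Proof.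
by move=> hx hy S hS; rewrite !ffunE hx // hy // scaler0 addr0.
Qed.

Fact koszul_cycles_closed i : submod_closed (in_cycles i).
Proof.
split=> [|a x y /asboolP[dx zx] /asboolP[dy zy]]; apply/asboolP; split.
- by move=> S _; rewrite ffunE.
- by rewrite linear0.
- exact: koszul_deg_closed.
- by rewrite koszul_d_linear zx zy scaler0 addr0.
Qed.

Fact koszul_boundaries_closed i : submod_closed (in_boundaries i).
Proof.
split=> [|a x y /asboolP[x' dx ->] /asboolP[y' dy ->]]; apply/asboolP.
  by exists 0; rewrite ?linear0 // => S _; rewrite ffunE.
by exists (a *: x' + y'); [exact: koszul_deg_closed | rewrite koszul_d_linear].
Qed.

Definition koszul_cycles i : submodClosed koszul :=
  Submod (koszul_cycles_closed i).
Definition koszul_boundaries i : submodClosed koszul :=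
  Submod (koszul_boundaries_closed i).

Definition koszul_homology (i : nat) : lmodType A :=
  subquot (koszul_cycles i) (koszul_boundaries i).

(* Extended-valued: if some length were infinite, so would be the sum.
   There are no nonzero chains in degree > m. *)
Definition koszul_char : \bar int :=
  (\sum_(i < m.+1) ((-1) ^+ i)%:E * module_length (koszul_homology i))%E.

End Koszul.

(* Main.v *)
(* Part (2) is the inequality dim A <= dim A/I + m, obtained from Krull's
   principal ideal theorem by moving the [u_i] one after the other into the
   bottom of a maximal chain of primes.  Part (1) holds because the Koszul Euler
   characteristic of a module of dimension < m vanishes, by induction on the
   number of generators: the characteristic is additive; it vanishes on modules
   killed by the last generator u, which reduces to a module on which u is
   regular; and there M can be traded for M/uM, of smaller dimension, without u.
   The subquotients P/Q of M occurring here are represented by the pairs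
   Q <= P, and localizations by a saturation operator on submodules. *)
From HB Require Import structures.
Require Import Defs.
From mathcomp Require Import all_boot all_order all_algebra generic_quotient.
From mathcomp Require Import boolp classical_sets constructive_ereal.
From mathcomp Require Import zify ring.

Set Implicit Arguments.
Unset Strict Implicit.
Unset Printing Implicit Defensive.

Import Order.TTheory GRing.Theory Num.Theory.
Local Open Scope ring_scope.

(** * Submodules *)

Section Submodules.
Context {R : pzRingType} {V W : lmodType R}.
Implicit Types (N : submodClosed V) (f : {linear V -> W}).

(** The induction passes through many subquotients, and finite length of [M / IM] is not visibly
    inherited by them. It is therefore first converted, by the determinant trick, into a condition
    on annihilators: up to a factor outside [q], a power of every element of [q] lies in the sum of
    [I] and the annihilator. This passes to subquotients because annihilators only grow, and when no
    generator is left it gives finite length of the subquotient itself. One notion of length serves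
    two ends. Krull's theorem needs lengths over the localization at a prime that need not be
    maximal, the Koszul part needs lengths over [A]; for [q = mm] everything outside [q] is a unit,
    saturation is the identity and [len] is the ordinary length. Part (2) feeds part (1):
    [dim M < m] excludes chains of [m] strict steps of primes above the annihilator of [M], which is
    the form of the dimension hypothesis carried by the induction. All Koszul complexes live in the
    single module of families indexed by subsets of ['I_m], so that dropping a generator changes no
    type. *)

Definition prop_submod (P : V -> Prop) : Prop :=
  P 0 /\ forall a x y, P x -> P y -> P (a *: x + y).

Fact asbool_submod_closed P : prop_submod P -> submod_closed (fun x : V => `[< P x >]).
Proof.
move=> [P0 PD]; split=> [|a x y /asboolP Px /asboolP Py]; apply/asboolP => //.
exact: PD.
Qed.

Definition mksub P (hP : prop_submod P) : submodClosed V :=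
  Submod (asbool_submod_closed hP).
Arguments mksub : simpl never.

Lemma mksubP P (hP : prop_submod P) x : reflect (P x) (x \in mksub hP).
Proof. exact: asboolP. Qed.

Lemma submodN N x : x \in N -> - x \in N.
Proof. by move=> Nx; rewrite -scaleN1r rpredZ. Qed.

Lemma submodB N x y : x \in N -> y \in N -> x - y \in N.
Proof. by move=> Nx Ny; rewrite rpredD ?submodN. Qed.

Lemma submodDl N x y : x \in N -> x + y \in N -> y \in N.
Proof. by move=> Nx Nxy; rewrite -[y](addKr x) rpredD ?submodN. Qed.

Lemma submodDr N x y : y \in N -> x + y \in N -> x \in N.
Proof. by rewrite addrC; apply: submodDl. Qed.

Fact sub_top_proof : prop_submod (fun=> True). Proof. by []. Qed.
Definition sub_top := mksub sub_top_proof.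
Lemma sub_topP x : x \in sub_top. Proof. exact/mksubP. Qed.

Fact sub0_proof : prop_submod (fun x => x = 0).
Proof. by split=> // a x y -> ->; rewrite scaler0 addr0. Qed.
Definition sub0 := mksub sub0_proof.
Lemma sub0P x : reflect (x = 0) (x \in sub0). Proof. exact: mksubP. Qed.

Fact cap_proof N1 N2 : prop_submod (fun x => x \in N1 /\ x \in N2).
Proof.
by split=> [|a x y [? ?] [? ?]]; split; rewrite ?rpred0 ?rpredD ?rpredZ.
Qed.
Definition cap N1 N2 := mksub (cap_proof N1 N2).
Lemma capP N1 N2 x : reflect (x \in N1 /\ x \in N2) (x \in cap N1 N2).
Proof. exact: mksubP. Qed.

Fact add_proof N1 N2 :
  prop_submod (fun x => exists y z, [/\ y \in N1, z \in N2 & x = y + z]).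
Proof.
split=> [|a _ _ [y [z [Ny Nz ->]]] [y' [z' [Ny' Nz' ->]]]].
  by exists 0, 0; rewrite !rpred0 addr0.
exists (a *: y + y'), (a *: z + z'); split; rewrite ?rpredD ?rpredZ //.
by rewrite scalerDr addrACA.
Qed.
Definition add N1 N2 := mksub (add_proof N1 N2).
Lemma addP N1 N2 x :
  reflect (exists y z, [/\ y \in N1, z \in N2 & x = y + z]) (x \in add N1 N2).
Proof. exact: mksubP. Qed.

Lemma sub_addl N1 N2 : {subset N1 <= add N1 N2}.
Proof. by move=> x Nx; apply/addP; exists x, 0; rewrite rpred0 addr0. Qed.

Lemma sub_addr N1 N2 : {subset N2 <= add N1 N2}.
Proof. by move=> x Nx; apply/addP; exists 0, x; rewrite rpred0 add0r. Qed.

Lemma add_min N1 N2 N :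
  {subset N1 <= N} -> {subset N2 <= N} -> {subset add N1 N2 <= N}.
Proof. by move=> s1 s2 x /addP[y [z [/s1 ? /s2 ? ->]]]; rewrite rpredD. Qed.

Fact pre_proof f (K : submodClosed W) : prop_submod (fun x => f x \in K).
Proof.
by split=> [|a x y Kx Ky]; rewrite ?linear0 ?rpred0 // linearP rpredD ?rpredZ.
Qed.
Definition pre f (K : submodClosed W) := mksub (pre_proof f K).
Lemma preP f (K : submodClosed W) x : reflect (f x \in K) (x \in pre f K).
Proof. exact: mksubP. Qed.

Lemma submod_gen_min (S : set V) N :
  (forall x, S x -> x \in N) -> {subset submod_gen S <= N}.
Proof.
move=> SN x /asboolP[s Ss ->]; rewrite big_seq rpred_sum // => p /Ss Sp.
by rewrite rpredZ ?SN.
Qed.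

Lemma submod_genP (S : set V) x : S x -> x \in submod_gen S.
Proof.
move=> Sx; apply/asboolP; exists [:: (1, x)]; last by rewrite big_seq1 scale1r.
by move=> p; rewrite inE => /eqP->.
Qed.

End Submodules.

Section Image.
Context {R : pzRingType} {V W : lmodType R}.

Fact img_proof (f : {linear V -> W}) (N : submodClosed V) :
  prop_submod (fun y => exists2 x, x \in N & y = f x).
Proof.
split=> [|a _ _ [x Nx ->] [y Ny ->]]; first by exists 0; rewrite ?linear0 ?rpred0.
by exists (a *: x + y); rewrite ?linearP // rpredD ?rpredZ.
Qed.
Definition img (f : {linear V -> W}) (N : submodClosed V) := mksub (img_proof f N).
Lemma imgP (f : {linear V -> W}) (N : submodClosed V) y :
  reflect (exists2 x, x \in N & y = f x) (y \in img f N).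
Proof. exact: mksubP. Qed.

End Image.

Arguments mksub : simpl never.
Arguments sub_top {R V}.
Arguments sub0 {R V}.

(** * Length *)

(* Lengths after localization at the prime [q], without localizing: [sat N] is
   the preimage of the localization of [N], and a step [Y <= Z] of a chain
   counts when it stays strict after localization. *)
Section Length.
Context {A : comNzRingType} (q : ideal A).
Hypothesis qP : prime_ideal q.

Lemma prime1 : (1 : A) \notin q. Proof. by case: qP. Qed.

Lemma primeM (a b : A) : a \notin q -> b \notin q -> a * b \notin q.
Proof. by case: qP => _ qM aq bq; apply/negP => /qM[]; apply/negP. Qed.

Fact sat_proof {V : lmodType A} (N : submodClosed V) :
  prop_submod (fun x => exists2 s : A, s \notin q & s *: x \in N).
Proof.
split; first by exists 1; rewrite ?prime1 // scaler0 rpred0.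
move=> a x y [s sq Nx] [t tq Ny]; exists (s * t); first exact: primeM.
rewrite scalerDr -[(s * t) *: (a *: x)]scalerA rpredD //; last first.
  by rewrite -scalerA rpredZ.
have -> : s *: (t *: (a *: x)) = (t * a) *: (s *: x).
  by rewrite !scalerA; congr (_ *: _); ring.
exact: rpredZ.
Qed.
Definition sat {V : lmodType A} (N : submodClosed V) := mksub (sat_proof N).

Context {V : lmodType A}.
Implicit Types B N X Y Z : submodClosed V.

Lemma satP N x : reflect (exists2 s : A, s \notin q & s *: x \in N) (x \in sat N).
Proof. exact: mksubP. Qed.

Lemma sub_sat N : {subset N <= sat N}.
Proof. by move=> x Nx; apply/satP; exists 1; rewrite ?prime1 ?scale1r. Qed.

Lemma sat_mono N N' : {subset N <= N'} -> {subset sat N <= sat N'}.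
Proof. by move=> NN' x /satP[s sq /NN' Nx]; apply/satP; exists s. Qed.

Lemma sat_cancel N s x : s \notin q -> s *: x \in sat N -> x \in sat N.
Proof.
move=> sq /satP[t tq]; rewrite scalerA => Nx.
by apply/satP; exists (t * s) => //; apply: primeM.
Qed.

(** The base case is an inclusion, not an equality, so that the interval from [B] to [Z] can be
    widened at either end without touching the chain. *)
Fixpoint chain n B Z : Prop :=
  if n is n'.+1 then
    exists Y, [/\ chain n' B Y, {subset Y <= Z} & ~ {subset Z <= sat Y}]
  else {subset B <= Z}.

Lemma chain_sub n B Z : chain n B Z -> {subset B <= Z}.
Proof. by elim: n Z => //= n IH Z [Y [/IH BY YZ _]] x /BY/YZ. Qed.

Lemma chain_top n B Z Z' : {subset Z <= Z'} -> chain n B Z -> chain n B Z'.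
Proof.
case: n => [|n] ZZ' /=; first by move=> BZ x /BZ/ZZ'.
case=> Y [cY YZ nZY]; exists Y; split=> // [x /YZ/ZZ' //|Z'Y].
by apply: nZY => x /ZZ'/Z'Y.
Qed.

Lemma chain_bot n B B' Z : {subset B' <= B} -> chain n B Z -> chain n B' Z.
Proof.
move=> BB; elim: n Z => [|n IH] Z /=; first by move=> BZ x /BB/BZ.
by case=> Y [/IH cY YZ nZY]; exists Y.
Qed.

Lemma chain_eq n B B' Z Z' : B =i B' -> Z =i Z' -> chain n B Z <-> chain n B' Z'.
Proof.
move=> BB ZZ; split=> c; [apply: (chain_top (Z := Z)) | apply: (chain_top (Z := Z'))].
- by move=> x; rewrite ZZ.
- by apply: chain_bot c => x; rewrite BB.
- by move=> x; rewrite ZZ.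
- by apply: chain_bot c => x; rewrite BB.
Qed.

Lemma chain_pred n B Z : chain n.+1 B Z -> chain n B Z.
Proof. by case=> Y [cY YZ _]; apply: chain_top cY. Qed.

Lemma chain_leq k n B Z : (k <= n)%N -> chain n B Z -> chain k B Z.
Proof.
elim: n => [|n IH]; first by rewrite leqn0 => /eqP->.
by rewrite leq_eqVlt => /orP[/eqP->//|/IH{}IH /chain_pred].
Qed.

Lemma chain_cat a b B Y Z : chain a B Y -> chain b Y Z -> chain (a + b) B Z.
Proof.
move=> cB; elim: b Z => [|b IH] Z /=; first by rewrite addn0 => YZ; apply: chain_top cB.
by case=> X [/IH cX XZ nZX]; rewrite addnS; exists X.
Qed.

(** Schreier's argument: intersect the terms of the chain with [Y], and add [Y] to them. If a step
    from [X] to [Z] collapses up to saturation on both sides, the modular law, with one denominator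
    from each side, gives [Z <= sat X]. So every strict step survives on at least one side. *)
Lemma chain_split n B Y Z : {subset B <= Y} -> chain n B Z ->
  exists a b, [/\ (n <= a + b)%N, chain a B (cap Z Y) & chain b Y (add Z Y)].
Proof.
move=> BY; elim: n Z => [|n IH] Z /=.
  move=> BZ; exists 0%N, 0%N; split=> //= [x Bx|]; last exact: sub_addr.
  by apply/capP; split; [apply: BZ | apply: BY].
case=> X [/IH[a [b [nab cX cX']]] XZ nZX].
have capXZ : {subset cap X Y <= cap Z Y}.
  by move=> x /capP[/XZ Zx Yx]; apply/capP.
have addXZ : {subset add X Y <= add Z Y}.
  by apply: add_min => x => [/XZ|]; [apply: sub_addl | apply: sub_addr].
have [cXZ|cXZ] := pselect {subset cap Z Y <= sat (cap X Y)}; last first.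
  exists a.+1, b; split=> //; last exact: chain_top cX'.
  by exists (cap X Y).
have [aXZ|aXZ] := pselect {subset add Z Y <= sat (add X Y)}; last first.
  exists a, b.+1; split; [by rewrite addnS | exact: chain_top cX | ].
  by exists (add X Y).
case: nZX => z Zz.
have /satP[s sq /addP[x [y [Xx Yy sz]]]] := aXZ z (sub_addl _ Zz).
have /cXZ/satP[t tq /capP[Xty _]] : y \in cap Z Y.
  apply/capP; split=> //; have -> : y = s *: z - x by rewrite sz addrC addKr.
  by rewrite submodB ?rpredZ //; apply: XZ.
apply/satP; exists (t * s); first exact: primeM.
by rewrite -scalerA sz scalerDr rpredD // rpredZ.
Qed.

Definition finlen B Z := {subset B <= Z} /\ exists n, ~ chain n B Z.
(** The value 0 is a default when no longest chain exists; [len] is meaningful under [finlen]. *)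
Definition len B Z : nat :=
  xget 0%N [set n | chain n B Z /\ ~ chain n.+1 B Z]%classic.

Lemma len_eq B B' Z Z' : B =i B' -> Z =i Z' ->
  (finlen B Z <-> finlen B' Z') /\ len B Z = len B' Z'.
Proof.
move=> BB ZZ; have cE n := chain_eq n BB ZZ; split.
  split=> -[BZ [n nc]]; split; first by apply/(cE 0%N).
  - by exists n => /cE.
  - by apply/(cE 0%N).
  - by exists n => /cE.
rewrite /len; congr xget; apply/seteqP.
by split=> n [c nc]; split=> [|c']; first [exact/cE | apply: nc; exact/cE].
Qed.

Lemma lenP B Z : finlen B Z -> chain (len B Z) B Z /\ ~ chain (len B Z).+1 B Z.
Proof.
case=> BZ [n ncn].
apply: (@xgetPex _ 0%N [set n | chain n B Z /\ ~ chain n.+1 B Z]%classic).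
elim: n ncn => [|n IH] //; have [cn|/IH//] := pselect (chain n B Z).
by exists n.
Qed.

Lemma len_chain k B Z : finlen B Z -> chain k B Z -> (k <= len B Z)%N.
Proof.
by move=> /lenP[_ nc] ck; rewrite leqNgt; apply/negP => /chain_leq/(_ ck).
Qed.

Lemma len_unique n B Z : chain n B Z -> ~ chain n.+1 B Z ->
  finlen B Z /\ len B Z = n.
Proof.
move=> cn ncn; have fBZ : finlen B Z by split; [apply: chain_sub cn | exists n.+1].
split=> //; have [c nc] := lenP fBZ; apply/eqP; rewrite eqn_leq len_chain // andbT.
by rewrite leqNgt; apply/negP => /chain_leq/(_ c).
Qed.

Lemma len_cat B Y Z : finlen B Y -> finlen Y Z ->
  finlen B Z /\ len B Z = (len B Y + len Y Z)%N.
Proof.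
move=> fBY fYZ; have [cBY _] := lenP fBY; have [cYZ _] := lenP fYZ.
apply: len_unique; first exact: chain_cat cBY cYZ.
move=> /(chain_split fBY.1)[a [b [+ ca cb]]]; rewrite ltnNge => /negP; apply.
apply: leq_add; apply: len_chain => //.
  by apply: chain_top ca => x /capP[].
by apply: chain_top cb; apply: add_min => //; apply: fYZ.1.
Qed.

Lemma finlen_split B Y Z : {subset B <= Y} -> {subset Y <= Z} -> finlen B Z ->
  finlen B Y /\ finlen Y Z.
Proof.
move=> BY YZ [BZ [n ncn]]; split; split=> //; exists n => cn; apply: ncn.
  exact: chain_top cn.
by rewrite -[n]add0n; apply: chain_cat cn.
Qed.

Lemma len_split B Y Z : {subset B <= Y} -> {subset Y <= Z} -> finlen B Z ->
  [/\ finlen B Y, finlen Y Z & len B Z = (len B Y + len Y Z)%N].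
Proof.
by move=> BY YZ /(finlen_split BY YZ)[fBY fYZ]; split=> //; case: (len_cat fBY fYZ).
Qed.

Lemma len_trivial B Z : {subset B <= Z} -> {subset Z <= sat B} ->
  finlen B Z /\ len B Z = 0%N.
Proof.
move=> BZ ZB; apply: len_unique => // -[Y [BY YZ]]; apply=> x /ZB.
exact: sat_mono.
Qed.

Lemma len_refl B : finlen B B /\ len B B = 0%N.
Proof. by apply: len_trivial => // x; apply: sub_sat. Qed.

Lemma len0_sat B Z : finlen B Z -> len B Z = 0%N -> {subset Z <= sat B}.
Proof.
move=> fBZ l0; apply: contrapT => nZB; have [_] := lenP fBZ; rewrite l0; apply.
by exists B; split=> //; apply: fBZ.1.
Qed.

End Length.

(** * Invariance of length under a linear map inducing an isomorphism from [Z / B] to [Z' / B'] *)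

Section Transport.
Context {A : comNzRingType} (q : ideal A) (qP : prime_ideal q).
Context {V W : lmodType A} (f : {linear V -> W}).
Variables (B Z : submodClosed V) (B' Z' : submodClosed W).
Hypothesis BZ : {subset B <= Z}.
Hypothesis BZ' : {subset B' <= Z'}.
Hypothesis fB : forall x, x \in B -> f x \in B'.
Hypothesis fZ : forall x, x \in Z -> f x \in Z'.
Hypothesis f_ker : forall x, x \in Z -> f x \in B' -> x \in B.
Hypothesis f_surj : forall y, y \in Z' ->
  exists2 x, x \in Z & y - f x \in B'.

Let chain_img n : chain qP n B Z -> chain qP n B' Z'.
Proof.
suff H (X : submodClosed V) : {subset X <= Z} -> chain qP n B X ->
    chain qP n B' (add (img f X) B').
  move=> /H-/(_ (fun x => id)); apply: chain_top.
  by apply: add_min => // _ /imgP[x Zx ->]; apply: fZ.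
elim: n X => [|n IH] X XZ; first by move=> _; exact: sub_addr.
case=> Y [cY YX nXY]; exists (add (img f Y) B'); split.
- by apply: IH => // x /YX/XZ.
- apply: add_min; last exact: sub_addr.
  by move=> _ /imgP[x Yx ->]; apply: sub_addl; apply/imgP; exists x; rewrite ?YX.
move=> XY; apply: nXY => x Xx.
have /XY/satP[s sq /addP[_ [b [/imgP[y Yy ->] Bb sx]]]] : f x \in add (img f X) B'.
  by apply: sub_addl; apply/imgP; exists x.
apply/satP; exists s => //; rewrite -[s *: x](subrK y) rpredD //.
apply: (chain_sub cY); apply: f_ker.
  by apply: submodB; [rewrite rpredZ ?XZ | apply/XZ/YX].
by rewrite linearB linearZ /= sx addrC addKr.
Qed.

Let chain_pre n : chain qP n B' Z' -> chain qP n B Z.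
Proof.
suff H (X : submodClosed W) : {subset X <= Z'} -> chain qP n B' X ->
    chain qP n B (cap Z (pre f X)).
  by move=> /H-/(_ (fun x => id)); apply: chain_top => x /capP[].
elim: n X => [|n IH] X XZ.
  by move=> BX x Bx; apply/capP; split; [apply: BZ | apply/preP/BX/fB].
case=> Y [cY YX nXY]; exists (cap Z (pre f Y)); split.
- by apply: IH => // x /YX/XZ.
- by move=> x /capP[Zx /preP/YX Xx]; apply/capP; split=> //; apply/preP.
move=> XY; apply: nXY => x Xx; have [z Zz Bxz] := f_surj (XZ _ Xx).
have BY := chain_sub cY.
have /XY/satP[s sq /capP[_ /preP]] : z \in cap Z (pre f X).
  apply/capP; split=> //; apply/preP.
  have -> : f z = x - (x - f z) by rewrite opprB addrC subrK.
  by apply: submodB => //; apply: YX; apply: BY.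
rewrite linearZZ => Yz; apply/satP; exists s => //.
by rewrite -[x](subrK (f z)) scalerDr rpredD // rpredZ ?BY.
Qed.

Lemma chain_transport n : chain qP n B Z <-> chain qP n B' Z'.
Proof. by split; [apply: chain_img | apply: chain_pre]. Qed.

Lemma finlen_transport : finlen qP B Z <-> finlen qP B' Z'.
Proof.
split=> -[_ [n nc]]; split=> //; exists n => c; apply: nc; exact/chain_transport.
Qed.

Lemma len_transport : len qP B Z = len qP B' Z'.
Proof.
by rewrite /len; congr xget; apply/seteqP; split=> n [c nc]; split;
  [|move=> ?; apply: nc| |move=> ?; apply: nc]; apply/chain_transport.
Qed.

End Transport.

(** * Noetherian modules *)

Section Noetherian.

Definition acc {R : pzRingType} (V : lmodType R) : Prop :=
  forall N : nat -> submodClosed V, (forall i, {subset N i <= N i.+1}) ->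
  exists n, forall k, {subset N k <= N n}.

Lemma chain_mono {R : pzRingType} {V : lmodType R} (N : nat -> submodClosed V) i j :
  (forall i, {subset N i <= N i.+1}) -> (i <= j)%N -> {subset N i <= N j}.
Proof.
move=> NS /subnK <-; elim: (j - i)%N => [|k IH] x // /IH; exact: NS.
Qed.

Lemma acc_max {R : pzRingType} {V : lmodType R} (P : submodClosed V -> Prop) X0 :
  acc V -> P X0 -> exists2 X, P X & forall Y, P Y -> {subset X <= Y} -> {subset Y <= X}.
Proof.
move=> accV PX0; apply: contrapT => nmax.
have /choice[f fP] : forall X, exists Y, P X ->
    [/\ P Y, {subset X <= Y} & ~ {subset Y <= X}].
  move=> X; apply: contrapT => nX; apply: nmax.
  have [PX|nPX] := pselect (P X); last by case: nX; exists X.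
  exists X => // Y PY XY; apply: contrapT => nYX.
  by apply: nX; exists Y.
pose N i := iter i f X0.
have PN i : P (N i) by elim: i => //= i /fP[].
have NS i : {subset N i <= N i.+1} by have [] := fP _ (PN i).
have [n /(_ n.+1)] := accV N NS.
by have [] := fP _ (PN n).
Qed.

Lemma acc_ring (A : comNzRingType) : noetherian_ring A -> acc (A^o : lmodType A).
Proof.
move=> noeA N NS.
have U_proof : prop_submod (fun x : A^o => exists i, x \in N i).
  split=> [|a x y [i Ni] [j Nj]]; first by exists 0%N; rewrite rpred0.
  exists (maxn i j); rewrite rpredD ?rpredZ //.
    exact: chain_mono NS (leq_maxl i j) _ Ni.
  exact: chain_mono NS (leq_maxr i j) _ Nj.
have [n [x xE]] := noeA (mksub U_proof).
have /choice[f fP] : forall k, exists i, (x k : A^o) \in N i.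
  by move=> k; apply/(mksubP U_proof); rewrite xE; apply: submod_genP; exists k.
exists (\max_k f k)%N => k y Ny.
have : y \in mksub U_proof by apply/mksubP; exists k.
rewrite xE; apply: submod_gen_min => _ [i _ <-].
exact: chain_mono NS (leq_bigmax i) _ (fP i).
Qed.

Fixpoint in_span {R : pzRingType} {V : lmodType R} (s : seq V) (z : V) : Prop :=
  if s is x :: s' then exists (a : R) y, in_span s' y /\ z = a *: x + y else z = 0.

Fact in_span_proof {R : pzRingType} {V : lmodType R} (s : seq V) : prop_submod (in_span s).
Proof.
elim: s => [|x s [IH0 IHD]]; first by split=> //= a x y -> ->; rewrite scaler0 addr0.
split=> [|a _ _ [b [y [sy ->]]] [c [z [sz ->]]]].
  by exists 0, 0; rewrite scale0r addr0.
exists (a * b + c), (a *: y + z); split; first exact: IHD.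
by rewrite scalerDr scalerDl scalerA addrACA.
Qed.

Lemma in_span_mem {R : pzRingType} {V : lmodType R} (s : seq V) z :
  z \in s -> in_span s z.
Proof.
elim: s => //= x s IH; rewrite inE => /orP[/eqP->|/IH sz].
  by exists 1, 0; rewrite scale1r addr0; split=> //; case: (in_span_proof s).
by exists 0, z; rewrite scale0r add0r.
Qed.

Lemma finitely_generated_span {R : pzRingType} {V : lmodType R} :
  finitely_generated V -> exists s : seq V, forall x, in_span s x.
Proof.
case=> s sV; exists s => x; apply/(mksubP (in_span_proof s)).
have := sV x; apply: submod_gen_min => y ys; apply/mksubP.
exact: in_span_mem.
Qed.

(** Induction on the spanning list. A chain is controlled by two pieces of data: the ideals of
    coefficients of the first generator, which stabilize in [A], and its trace on the span of the
    remaining generators, which stabilizes by induction. *)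
Lemma acc_module (A : comNzRingType) (V : lmodType A) :
  noetherian_ring A -> finitely_generated V -> acc V.
Proof.
move=> noeA /finitely_generated_span[s sV] N NS.
suff: exists n, forall k x, in_span s x -> x \in N k -> x \in N n.
  by case=> n nP; exists n => k x Nx; apply: (nP k).
elim: s {sV} => [|x s [n1 n1P]]; first by exists 0%N => k x ->; rewrite !rpred0.
have J_proof i : prop_submod (fun a : A^o =>
    exists2 y, in_span s y & (a : A) *: x + y \in N i).
  split=> [|a b c [y sy Ny] [z sz Nz]].
    by exists 0; [case: (in_span_proof s) | rewrite (scale0r x) addr0 rpred0].
  exists (a *: y + z); first by apply: (in_span_proof s).2.
  by rewrite scalerDl -scalerA addrACA -scalerDr rpredD ?rpredZ.
have [i b /mksubP[y sy Ny]|n2 n2P] := acc_ring noeA (N := fun i => mksub (J_proof i)).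
  by apply/mksubP; exists y => //; apply: NS.
exists (maxn n1 n2) => k z [a [y [sy zE]]] Nz.
have /n2P/mksubP[y' sy' Ny'] : (a : A^o) \in mksub (J_proof k).
  by apply/mksubP; exists y; rewrite -?zE.
pose l := maxn k n2.
have Nl : y - y' \in N l.
  have -> : y - y' = z - (a *: x + y') by rewrite zE opprD addrACA subrr add0r.
  apply: submodB; first exact: chain_mono NS (leq_maxl _ _) _ Nz.
  exact: chain_mono NS (leq_maxr _ _) _ Ny'.
have {}Nl : y - y' \in N n1.
  apply: (n1P l) => //; have [s0 sD] := in_span_proof s.
  by rewrite addrC -scaleN1r; apply: sD.
have -> : z = (a *: x + y') + (y - y') by rewrite zE -addrA [y' + _]addrC subrK.
rewrite rpredD //; first exact: chain_mono NS (leq_maxr _ _) _ Ny'.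
exact: chain_mono NS (leq_maxl _ _) _ Nl.
Qed.

End Noetherian.

(** * Finite length from [q]-power torsion *)

Section FiniteLength.
Context {A : comNzRingType} (noeA : noetherian_ring A).
Context (q : ideal A) (qP : prime_ideal q).
Context {V : lmodType A} (accV : acc V).

(** Treat the elements of [s] one at a time, each time multiplying by the last power that does not
    yet send the current multiple of [x] into [N]. *)
Lemma annihilated_mod (N : submodClosed V) (s : seq A) x :
    (forall a, a \in s -> exists k, a ^+ k *: x \in N) -> x \notin N ->
  exists c : A, c *: x \notin N /\ forall a, a \in s -> a *: (c *: x) \in N.
Proof.
elim: s => [|a s IH] sN xN; first by exists 1; rewrite scale1r.
have [b bs|c [cN cP]] := IH _ xN; first by apply: sN; rewrite inE bs orbT.
have exk : exists k, a ^+ k *: (c *: x) \in N.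
  have [|k Nk] := sN a; first by rewrite inE eqxx.
  by exists k; rewrite scalerA mulrC -scalerA rpredZ.
case: (ex_minnP exk) => -[|k] Nk kmin; first by rewrite expr0 scale1r (negPf cN) in Nk.
exists (a ^+ k * c); rewrite -scalerA; split=> [|b].
  by apply/negP => /kmin; rewrite ltnn.
rewrite inE => /orP[/eqP->|/cP bN]; first by rewrite scalerA -exprS.
by rewrite scalerA mulrC -scalerA rpredZ.
Qed.

(* Each simple step of the filtration adds an element [y] with [q *: y] in the
   previous submodule, up to saturation. *)
Lemma finlen_torsion (Q P : submodClosed V) : {subset Q <= P} ->
    (forall a : A, a \in q -> exists2 s : A, s \notin q &
       exists k, forall x, x \in P -> (s * a ^+ k) *: x \in Q) ->
  finlen qP Q P.
Proof.
move=> QP tors.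
have [|R [QR RP fQR] Rmax] := acc_max (P := fun R =>
    [/\ {subset Q <= R}, {subset R <= P} & finlen qP Q R]) (X0 := Q) accV.
  by split=> //; apply: (len_refl _ _).1.
have [PR|/existsNP[x /not_implyP[Px /negP xR]]] := pselect {subset P <= sat qP R}.
  exact: (len_cat fQR (len_trivial RP PR).1).1.
have [n [g gE]] := noeA q.
have [a /codomP[i ->]|c []] := @annihilated_mod (sat qP R) (codom g) x _ xR.
  have /tors[s sq [k sk]] : g i \in q by rewrite gE; apply: submod_genP; exists i.
  exists k; apply: (sat_cancel (s := s)) => //.
  by rewrite scalerA; apply/sub_sat/QR/sk.
have: c *: x \in P by rewrite rpredZ.
move: (c *: x) => y Py yR gy.
have qy b : (b : A^o) \in q -> b *: y \in sat qP R.
  have J_proof : prop_submod (fun b : A^o => (b : A) *: y \in sat qP R).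
    split=> [|a b1 b2 Rb1 Rb2]; first by rewrite (scale0r y) rpred0.
    by rewrite scalerDl -scalerA rpredD // rpredZ.
  rewrite gE => bg; apply/(mksubP J_proof); apply: submod_gen_min bg => _ [i _ <-].
  by apply/mksubP/gy; apply: codom_f.
have T_proof : prop_submod (fun z => exists2 r, r \in R & exists a : A, z = r + a *: y).
  split=> [|a _ _ [r Rr [b ->]] [r' Rr' [b' ->]]].
    by exists 0; rewrite ?rpred0 //; exists 0; rewrite scale0r addr0.
  exists (a *: r + r'); first by rewrite rpredD ?rpredZ.
  by exists (a * b + b'); rewrite scalerDr scalerDl scalerA addrACA.
pose T := mksub T_proof.
have RT : {subset R <= T}.
  by move=> r Rr; apply/mksubP; exists r => //; exists 0; rewrite scale0r addr0.
have Ty : y \in T.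
  by apply/mksubP; exists 0; rewrite ?rpred0 //; exists 1; rewrite scale1r add0r.
have fRT : finlen qP R T.
  (* The step from [R] to [T] has length at most 1. In a chain [Y0 < Y1 < T], an element
     [r + a *: y] of [Y1] outside [sat Y0] has [a] outside [q]; then [y] is in [sat Y1], and so is
     all of [T]. *)
  split=> //; exists 2 => -[Y1 [[Y0 [RY0 Y01 nY10]] Y1T nTY1]].
  apply: nY10 => w Y1w; apply: contrapT => wY0.
  have /mksubP[r Rr [a wE]] := Y1T _ Y1w.
  have aq : a \notin q.
    apply/negP => /qy Ray; apply: wY0; apply: (sat_mono RY0).
    by rewrite wE rpredD // sub_sat.
  have RY1 z : z \in R -> z \in Y1 by move=> /RY0/Y01.
  have Yy : y \in sat qP Y1.
    apply/satP; exists a => //.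
    have -> : a *: y = w - r by rewrite wE addrC addKr.
    by apply: submodB => //; apply: RY1.
  apply: nTY1 => _ /mksubP[r' Rr' [a' ->]].
  by rewrite rpredD ?rpredZ //; apply: sub_sat; apply: RY1.
case/negP: yR; apply/sub_sat/(Rmax T) => //; split.
- by move=> z /QR/RT.
- by move=> _ /mksubP[r Rr [a ->]]; rewrite rpredD ?rpredZ //; apply: RP.
- exact: (len_cat fQR fRT).1.
Qed.

End FiniteLength.

(** * Krull's principal ideal theorem *)

Section ScaleLinear.
Context {A : comNzRingType} {V : lmodType A} (c : A).

Definition scale_by (x : V) : V := c *: x.

Fact scale_by_linear : linear scale_by.
Proof. by move=> a x y; rewrite /scale_by scalerDr !scalerA mulrC. Qed.

HB.instance Definition _ :=
  GRing.isLinear.Build A V V *:%R scale_by scale_by_linear.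

End ScaleLinear.

Section Primes.
Context {A : comNzRingType} (noeA : noetherian_ring A).
Implicit Types (J p q : ideal A) (a b u : A).

Lemma idealM J a b : (b : A^o) \in J -> (a * b : A^o) \in J.
Proof. by move=> Jb; apply: (@rpredZ _ _ J). Qed.

Lemma prime_pow p a n : prime_ideal p -> a ^+ n \in p -> a \in p.
Proof.
move=> [p1 pM]; elim: n => [|n IH]; first by rewrite expr0 (negPf p1).
by rewrite exprS => /pM[|/IH].
Qed.

(** Take [p] maximal among the ideals above [J] that avoid [S]. If [a] and [b] are outside [p], both
    [p + (a)] and [p + (b)] meet [S]; the product of the two elements found is in [S] and in
    [p + (a * b)], so [a * b] is outside [p]. *)
Lemma prime_disjoint (J : ideal A) (S : A -> Prop) :
    S 1 -> (forall a b, S a -> S b -> S (a * b)) -> (forall a, a \in J -> ~ S a) ->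
  exists p : ideal A, [/\ prime_ideal p, {subset J <= p} & forall a, a \in p -> ~ S a].
Proof.
move=> S1 SM JS.
have [|p [Jp pS] pmax] := acc_max (P := fun p : submodClosed A^o =>
  {subset J <= p} /\ forall a, a \in p -> ~ S a) (X0 := J) (acc_ring noeA); first by split.
exists p; split=> //; split; first by apply/negP => /pS.
have meets a : a \notin p -> exists s x r, [/\ S s, x \in p & s = x + r * a].
  move=> ap; apply: contrapT => nS; case/negP: ap.
  apply: (pmax (add p (img (scale_by a) sub_top))); last first.
  - apply: sub_addr; apply/imgP; exists 1; first exact: sub_topP.
    exact: (esym (mulr1 a)).
  - exact: sub_addl.
  split=> [x /Jp|s]; first exact: sub_addl.
  move=> /addP[x [_ [px /imgP[r _ ->] sE]]] Ss; apply: nS.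
  by exists s, x, (r : A); split=> //; rewrite [_ * a]mulrC; exact: sE.
move=> a b pab; case: (boolP (a \in p)) => [|ap]; first by left.
case: (boolP (b \in p)) => [|bp]; first by right.
have [s [x [r [Ss px sE]]]] := meets a ap.
have [t [y [r' [St py tE]]]] := meets b bp.
case: (pS (s * t)); last exact: SM.
have -> : s * t = (s * y + (r' * b) * x) + (r * r') * (a * b).
  by rewrite tE sE; ring.
by apply: rpredD; [apply: rpredD|]; apply: idealM.
Qed.

Section PrincipalIdealTheorem.
Variables (p r : ideal A) (u : A).
Hypotheses (pP : prime_ideal p) (rP : prime_ideal r).

Let P b : ideal A := add p (img (scale_by b) sub_top).

Let PP b x : reflect (exists y z, y \in p /\ x = y + b * z) (x \in P b).
Proof.
apply: (iffP (addP _ _ _)) => [[y [_ [py /imgP[z _ ->] ->]]]|[y [z [py ->]]]].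
  by exists y, z.
exists y, (b * z); split=> //; apply/imgP; exists z => //; exact: sub_topP.
Qed.

Let Pp b : {subset p <= P b}. Proof. exact: sub_addl. Qed.
Let Pb b z : b * z \in P b.
Proof. by apply/PP; exists 0, z; rewrite rpred0 add0r. Qed.

Let Pbb b : b \in P b.
Proof. by have := Pb b 1; rewrite mulr1. Qed.

(** Multiplication by [a] is injective on the domain [A / p], hence maps [((p, b) : a) / (p, b)]
    isomorphically onto the quotient of the intersection of [(p, a)] and [(p, b)] by
    [(p, a * b)]. *)
Let colon_cap a b : a \notin p ->
  (finlen rP (P b) (pre (scale_by a) (P b)) <->
     finlen rP (P (a * b)) (cap (P a) (P b))) /\
  len rP (P b) (pre (scale_by a) (P b)) = len rP (P (a * b)) (cap (P a) (P b)).
Proof.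
move=> ap.
have sub_colon : {subset P b <= pre (scale_by a) (P b)}.
  by move=> x Px; apply/preP/rpredZ.
have sub_cap : {subset P (a * b) <= cap (P a) (P b)}.
  move=> _ /PP[y [z [py ->]]]; apply/capP; split; apply/PP.
    by exists y, (b * z); rewrite mulrA.
  by exists y, (a * z); rewrite mulrCA mulrA.
have fB x : x \in P b -> scale_by a x \in P (a * b).
  move=> /PP[y [z [py ->]]]; apply/PP; exists (a * y), z; split; first exact: idealM.
  by rewrite -mulrA -mulrDr.
have fZ x : x \in pre (scale_by a) (P b) -> scale_by a x \in cap (P a) (P b).
  by move=> /preP Pax; apply/capP; split=> //; apply: Pb.
have f_ker x : x \in pre (scale_by a) (P b) -> scale_by a x \in P (a * b) -> x \in P b.
  move=> _ /PP[y [z [py xE]]]; apply/PP; exists (x - b * z), z; rewrite subrK; split=> //.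
  have : a * (x - b * z) \in p.
    have -> : a * (x - b * z) = y by rewrite mulrBr -[a * x]/(scale_by a x) xE mulrA addrK.
    by [].
  by case/pP.2 => //; rewrite (negPf ap).
have f_surj y : y \in cap (P a) (P b) ->
    exists2 x : A^o, x \in pre (scale_by a) (P b) & y - scale_by a x \in P (a * b).
  move=> /capP[/PP[z [x [pz yE]]] Py]; exists (x : A^o); last first.
    by rewrite yE addrK; apply: Pp.
  have : y - z \in P b by apply: submodB => //; apply: Pp.
  have -> : y - z = scale_by a (x : A^o) by rewrite yE addrC addKr.
  by move=> Pax; apply/preP.
split; first exact: (finlen_transport (f := scale_by a) rP sub_colon sub_cap).
exact: (len_transport (f := scale_by a) rP sub_colon sub_cap).
Qed.

(** Multiplication by [a] identifies [A / ((p, b) : a)] with [(p, a, b) / (p, b)]. Computing the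
    length of [A / (p, b)] through either ideal and cancelling shows that [A / (p, a, b)] has the
    length of [((p, b) : a) / (p, b)]. By [colon_cap], the latter is symmetric in [a] and [b]. *)
Let colon_len a b : a \notin p -> b \notin p -> finlen rP (P b) sub_top ->
  finlen rP (add (P a) (P b)) sub_top /\
  len rP (add (P a) (P b)) sub_top = len rP (P a) (pre (scale_by b) (P a)).
Proof.
move=> ap bp fb.
have [f1 l1] := colon_cap b ap; have [f2 l2] := colon_cap a bp.
have topS (N : ideal A) : {subset N <= @sub_top A A^o} by move=> x _; apply: sub_topP.
have sub_colon : {subset P b <= pre (scale_by a) (P b)}.
  by move=> x Px; apply/preP/rpredZ.
have [f3 f4 l3] := len_split sub_colon (topS _) fb.
have [f5 f6 l5] := len_split (@sub_addr _ _ (P a) (P b)) (topS _) fb.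
split=> //.
have l6 : len rP (pre (scale_by a) (P b)) sub_top = len rP (P b) (add (P a) (P b)).
  apply: (len_transport (f := scale_by a) rP) => //.
  - exact: sub_addr.
  - by move=> x /preP.
  - by move=> x _; apply: sub_addl; apply: Pb.
  - by move=> x _ /preP.
  move=> _ /addP[_ [z [/PP[y [x [py ->]]] Pz ->]]]; exists (x : A^o); first exact: sub_topP.
  have -> : y + a * x + z - scale_by a (x : A^o) = y + z by rewrite addrAC addrK.
  by rewrite rpredD //; apply: Pp.
have [_ capC] : (finlen rP (P (b * a)) (cap (P b) (P a)) <->
    finlen rP (P (a * b)) (cap (P a) (P b))) /\
    len rP (P (b * a)) (cap (P b) (P a)) = len rP (P (a * b)) (cap (P a) (P b)).
  by rewrite mulrC; apply: len_eq => // x; apply/capP/capP => -[].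
by rewrite l2 capC -l1; move: l5; rewrite l3 l6 addnC => /addnI.
Qed.

(* With lengths at [r], the length of [A / (p, a, u^n)] is that of
   [((p, a) : u^n) / (p, a)], hence constant for [n] large. *)
Lemma principal_ideal_step (p1 : ideal A) :
    prime_ideal p1 -> {subset p <= p1} -> ~ {subset p1 <= p} -> {subset p1 <= r} ->
    u \in r -> u \notin p1 ->
  exists p' : ideal A,
    [/\ prime_ideal p', {subset p <= p'}, u \in p', {subset p' <= r} & ~ {subset r <= p'}].
Proof.
move=> p1P pp1 /existsNP[a /not_implyP[p1a /negP ap]] p1r ur up1.
apply: contrapT => nex.
have up n : u ^+ n \notin p.
  by apply/negP => /(prime_pow pP)/pp1; rewrite (negPf up1).
(* Without an intermediate prime, each [b] in [r] is nilpotent modulo [(p, u^n)] up to a factor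
   outside [r]: otherwise some prime over [(p, u^n)] avoids all [s * b ^+ k], so it contains [u],
   lies in [r] and misses [b]. *)
have fin_pow n : finlen rP (P (u ^+ n)) sub_top.
  apply: (finlen_torsion noeA) => [|x _|b rb]; [exact: acc_ring | exact: sub_topP |].
  apply: contrapT => nt.
  have [||c Pc [s [k [sr cE]]]|p' [p'P Pp' p'S]] :=
      @prime_disjoint (P (u ^+ n)) (fun c => exists s k, s \notin r /\ c = s * b ^+ k).
  - by exists 1, 0%N; rewrite expr0 mulr1; split=> //; apply: prime1.
  - move=> _ _ [s [k [sr ->]]] [t [l [tr ->]]]; exists (s * t), (k + l)%N.
    by split; [apply: primeM | rewrite exprD mulrACA].
  - apply: nt; exists s => //; exists k => x _.
    by rewrite -cE; have := idealM x Pc; rewrite mulrC.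
  apply: nex; exists p'; split=> //.
  - by move=> x /Pp/Pp'.
  - by apply: (prime_pow (n := n)) => //; apply: Pp'; apply: Pbb.
  - move=> x p'x; apply: contrapT => /negP xr.
    by case: (p'S x p'x); exists x, 0%N; rewrite expr0 mulr1.
  move=> /(_ b rb) p'b; case: (p'S b p'b); exists 1, 1%N.
  by rewrite expr1 mul1r; split=> //; apply: prime1.
pose C n := pre (scale_by (u ^+ n)) (P a).
have [n Cn] : exists n, forall k, {subset C k <= C n}.
  apply: (acc_ring noeA) => k x /preP Pkx; apply/preP.
  have := idealM u (b := scale_by (u ^+ k) x) Pkx.
  by rewrite [u * _](mulrA u) -exprS.
have CE : C n =i C n.+1.
  move=> x; apply/idP/idP; last exact: Cn.
  move=> /preP Pkx; apply/preP.
  have := idealM u (b := scale_by (u ^+ n) x) Pkx.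
  by rewrite [u * _](mulrA u) -exprS.
pose T k := add (P a) (P (u ^+ k)).
have [fT lT] := colon_len ap (up n) (fin_pow n).
have [fT' lT'] := colon_len ap (up n.+1) (fin_pow n.+1).
have lTT : len rP (T n.+1) sub_top = len rP (T n) sub_top.
  by rewrite lT lT'; apply: esym; apply: (len_eq _ _ CE).2.
have TT : {subset T n.+1 <= T n}.
  apply: add_min => [|x /PP[y [z [py ->]]]]; first exact: sub_addl.
  by apply: sub_addr; apply/PP; exists y, (u * z); rewrite exprSr mulrA.
have [fTT _ lTTE] := len_split TT (fun x _ => sub_topP x) fT'.
have lTT0 : len rP (T n.+1) (T n) = 0%N.
  by apply/eqP; rewrite -(eqn_add2r (len rP (T n) sub_top)) -lTTE lTT.
have /(len0_sat fTT lTT0)/satP[s sr] : (u ^+ n : A^o) \in T n.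
  by apply: sub_addr; apply: Pbb.
move=> /addP[_ [_ [/PP[y [z [py ->]]] /PP[y' [z' [py' ->]]] sE]]].
(* Here the choice of [a] in [p1] but not in [p] pays off: modulo [p1] only the multiple of
   [u ^+ n.+1] remains. As [p1] misses [u], the factor [s - z' * u] is in [p1], hence [s] is in [r],
   a contradiction. *)
have : (s - z' * u) * u ^+ n \in p1.
  have -> : (s - z' * u) * u ^+ n = y + a * z + y'.
    rewrite mulrBl -[s * _]/(s *: (u ^+ n : A^o)) sE exprS; ring.
  apply: rpredD; last exact: pp1.
  by apply: rpredD; [exact: pp1 | rewrite mulrC; apply: idealM].
case/p1P.2 => [/p1r|/(prime_pow p1P)]; last by rewrite (negPf up1).
move=> rsu; case/negP: sr; apply: (submodDr (x := s : A^o) (y := - (z' * u) : A^o) _ rsu).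
by apply: submodN; apply: idealM.
Qed.

End PrincipalIdealTheorem.

(** Built upwards from the bottom prime [p], because the generators are inserted at the bottom; only
    the top prime is required to contain [E]. *)
Fixpoint prime_chain_over (E : ideal A) n (p : ideal A) : Prop :=
  prime_ideal p /\
  if n is n'.+1 then
    exists p1 : ideal A, [/\ {subset p <= p1}, ~ {subset p1 <= p} & prime_chain_over E n' p1]
  else {subset E <= p}.

Lemma prime_chain_overS E n p : prime_chain_over E n p -> prime_ideal p.
Proof. by case: n => [|n] []. Qed.

(** One strict step is the price for having [u] in the bottom prime. By induction on the chain above
    [p1] there is a chain starting at some [r] that contains [p1] and [u]; [principal_ideal_step]
    then replaces [p1], between [p] and [r], by a prime containing [u]. *)
Lemma prime_chain_drop (E : ideal A) n p u : prime_chain_over E n.+1 p -> u \in E ->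
  exists p' : ideal A, [/\ {subset p <= p'}, u \in p' & prime_chain_over E n p'].
Proof.
move=> + uE; elim: n p => [|n IH] p [pP [p1 [pp1 np1p c1]]].
  by exists p1; split=> //; case: c1 => _ /(_ _ uE).
have {}c1 : prime_chain_over E n.+1 p1 by [].
have p1P := prime_chain_overS c1.
case: (boolP (u \in p1)) => [up1|up1]; first by exists p1.
have [r [p1r ur cr]] := IH p1 c1.
have rP := prime_chain_overS cr.
have [p' [p'P pp' up' p'r nrp']] := principal_ideal_step pP rP p1P pp1 np1p p1r ur up1.
by exists p'; split=> //; split=> //; exists r.
Qed.

Lemma prime_chain_drops (E : ideal A) n (s : seq A) p :
    prime_chain_over E (size s + n) p -> {subset s <= E} ->
  exists p' : ideal A, [/\ {subset p <= p'}, {subset s <= p'} & prime_chain_over E n p'].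
Proof.
elim: s p => [|u s IH] p c sE; first by exists p; split=> // x; rewrite in_nil.
have [|p1 [pp1 up1 c1]] := prime_chain_drop c (u := u); first by apply: sE; rewrite inE eqxx.
have [|p' [p1p' sp' cp']] := IH p1 c1.
  by move=> x xs; apply: sE; rewrite inE xs orbT.
exists p'; split=> // [x /pp1/p1p'//|x]; rewrite inE => /orP[/eqP->|/sp'//].
exact: p1p'.
Qed.

End Primes.

(** * Koszul homology of subquotients *)

Section KoszulInPlace.
Context {A : comNzRingType} {m : nat} (u : 'I_m -> A) (M : lmodType A).
Implicit Types (P Q R : submodClosed M) (x y z w : @koszul A m M) (S T : {set 'I_m}).
Implicit Types (n i e : nat).

Local Notation d := (@koszul_d A m u M).

Definition below n : {set 'I_m} := [set k : 'I_m | (k < n)%N]%SET.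

Fact kval_proof P : prop_submod (fun x => forall S, x S \in P).
Proof.
split=> [S|a x y Px Py S]; first by rewrite ffunE rpred0.
by rewrite !ffunE rpredD ?rpredZ.
Qed.
Definition kval P := mksub (kval_proof P).
Lemma kvalP P x : reflect (forall S, x S \in P) (x \in kval P).
Proof. exact: mksubP. Qed.

(* The degree [i - e] part of the Koszul complex of [u_0, ..., u_(n-1)] with
   coefficients in [P]; it vanishes for [i < e]. *)
Fact kpart_proof n e i P : prop_submod (fun x => (forall S, x S \in P) /\
  forall S, ~~ ((#|S| + e == i)%N && (S \subset below n)) -> x S = 0).
Proof.
split=> [|a x y [Px x0] [Py y0]]; split=> S; rewrite ?ffunE ?rpred0 //.
  by rewrite rpredD // rpredZ.
by move=> nS; rewrite x0 // y0 // scaler0 addr0.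
Qed.
Definition kpart n e i P := mksub (kpart_proof n e i P).
Lemma kpartP n e i P x : reflect ((forall S, x S \in P) /\
  forall S, ~~ ((#|S| + e == i)%N && (S \subset below n)) -> x S = 0) (x \in kpart n e i P).
Proof. exact: mksubP. Qed.

Lemma kpart_kval n e i P x : x \in kpart n e i P -> x \in kval P.
Proof. by case/kpartP => Px _; apply/kvalP. Qed.

Lemma kpart_mono n e i P Q x : {subset P <= Q} -> x \in kpart n e i P -> x \in kpart n e i Q.
Proof. by move=> PQ /kpartP[Px x0]; apply/kpartP; split=> // S; apply: PQ. Qed.

Lemma kval_mono P Q x : {subset P <= Q} -> x \in kval P -> x \in kval Q.
Proof. by move=> PQ /kvalP Px; apply/kvalP => S; apply: PQ. Qed.

Lemma kpart_valued n e i P Q x : x \in kpart n e i P -> x \in kval Q -> x \in kpart n e i Q.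
Proof. by move=> /kpartP[_ x0] /kvalP Qx; apply/kpartP. Qed.

Lemma kpart_shift n e i P : kpart n e.+1 i.+1 P =i kpart n e i P.
Proof.
by move=> x; apply/kpartP/kpartP => -[Px x0]; split=> // S; move: (x0 S);
  rewrite addnS eqSS.
Qed.

Lemma kpart_neg n e P x : x \in kpart n e.+1 0 P -> x = 0.
Proof. by case/kpartP => _ x0; apply/ffunP => S; rewrite ffunE x0 // addnS. Qed.

Lemma kpart_big n P x : x \in kpart n 0 m.+1 P -> x = 0.
Proof.
case/kpartP => _ x0; apply/ffunP => S; rewrite ffunE x0 // addn0 negb_and.
by rewrite neq_ltn ltnS -[X in (_ <= X)%N]card_ord max_card.
Qed.

Lemma kpart_top n P x : (n < m)%N -> x \in kpart n 0 m P -> x = 0.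
Proof.
move=> nm /kpartP[_ x0]; apply/ffunP => S; rewrite ffunE x0 // addn0.
apply/negP => /andP[/eqP cS /fintype.subsetP Sn]; have : Ordinal nm \in S.
  suff -> : S = [set: 'I_m]%SET by rewrite finset.inE.
  by apply/eqP; rewrite eqEcard finset.subsetT cardsT card_ord cS leqnn.
by move/Sn; rewrite finset.inE ltnn.
Qed.

Lemma kd_kval P x : x \in kval P -> d x \in kval P.
Proof.
move=> /kvalP Px; apply/kvalP => S; rewrite ffunE rpred_sum // => j _.
by rewrite rpredZ.
Qed.

Lemma kd_kpart n e i P x : x \in kpart n e i P -> d x \in kpart n e.+1 i P.
Proof.
move=> Px; apply/kpartP; split; first exact/kvalP/kd_kval/(kpart_kval Px).
case/kpartP: Px => _ x0 S nS; rewrite ffunE big1 // => j jS; rewrite x0 ?scaler0 //.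
apply: contra nS; rewrite cardsU1 jS add1n addSnnS => /andP[-> /fintype.subsetP jSn] /=.
by apply/fintype.subsetP => k kS; apply: jSn; rewrite !finset.inE kS orbT.
Qed.

Lemma kd_kpartS n e i P x : x \in kpart n e i.+1 P -> d x \in kpart n e i P.
Proof. by move=> /kd_kpart; rewrite kpart_shift. Qed.

Lemma kdd x : d (d x) = 0. Proof. exact: koszul_dd. Qed.

(* [kcycles / kbounds] is the homology of the Koszul complex of [P / Q], seen
   inside the Koszul complex of [M]. *)
Definition kcycles n e i P Q := cap (kpart n e i P) (pre d (kval Q)).
Definition kbounds n e i P Q := add (img d (kpart n e i.+1 P)) (kpart n e i Q).

Lemma kcyclesP n e i P Q x :
  reflect (x \in kpart n e i P /\ d x \in kval Q) (x \in kcycles n e i P Q).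
Proof.
apply: (iffP (capP _ _ _)) => [[Px /preP Qdx]|[Px Qdx]]; split=> //.
exact/preP.
Qed.

Lemma kboundsP n e i P Q x :
  reflect (exists y w, [/\ y \in kpart n e i.+1 P, w \in kpart n e i Q & x = d y + w])
    (x \in kbounds n e i P Q).
Proof.
apply: (iffP (addP _ _ _)) => [[_ [w [/imgP[y Py ->] Qw ->]]]|[y [w [Py Qw ->]]]].
  by exists y, w.
by exists (d y), w; split=> //; apply/imgP; exists y.
Qed.

Lemma kbounds_d n e i P Q y : y \in kpart n e i.+1 P -> d y \in kbounds n e i P Q.
Proof. by move=> Py; apply/kboundsP; exists y, 0; rewrite rpred0 addr0. Qed.

Lemma kbounds_r n e i P Q w : w \in kpart n e i Q -> w \in kbounds n e i P Q.
Proof. by move=> Qw; apply/kboundsP; exists 0, w; rewrite rpred0 linear0 add0r. Qed.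

Lemma kbounds_cycles n e i P Q : {subset Q <= P} ->
  {subset kbounds n e i P Q <= kcycles n e i P Q}.
Proof.
move=> QP _ /kboundsP[y [w [Py Qw ->]]]; apply/kcyclesP; split.
  by rewrite rpredD ?kd_kpartS //; apply: kpart_mono Qw.
by rewrite linearD /= kdd add0r kd_kval // (kpart_kval Qw).
Qed.

Context (q : ideal A) (qP : prime_ideal q).

Definition kfin n e P Q :=
  forall i, finlen qP (kbounds n e i P Q) (kcycles n e i P Q).

Definition klen n e i P Q := len qP (kbounds n e i P Q) (kcycles n e i P Q).

Definition kchi n P Q : int := \sum_(i < m.+1) (-1) ^+ i * (klen n 0 i P Q)%:Z.

(** Both Euler characteristic computations below end here: only the top value of [f] survives, and
    it vanishes in each use. *)
Lemma alternating_telescope (f g : nat -> int) k :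
  g 0%N = f 0%N -> (forall i, g i.+1 = f i.+1 + f i) ->
  \sum_(i < k.+1) (-1) ^+ i * g i = (-1) ^+ k * f k.
Proof.
move=> g0 gS; elim: k => [|k IH]; first by rewrite big_ord_recl big_ord0 addr0 g0.
by rewrite big_ord_recr /= IH gS exprS mulN1r !mulNr mulrDr opprD addrC addrNK.
Qed.

(* In the proof, [e i] is the length of the image of the connecting map from
   degree [i] to degree [i - 1]. *)
Lemma kchi_add n P R Q : {subset Q <= R} -> {subset R <= P} ->
    kfin n 0 R Q -> kfin n 0 P R ->
  kfin n 0 P Q /\ kchi n P Q = kchi n R Q + kchi n P R.
Proof.
move=> QR RP fRQ fPR; have QP : {subset Q <= P} by move=> x /QR/RP.
(* These cut the long exact homology sequence of [R/Q -> P/Q -> P/R] into short ones. Modulo the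
   respective boundaries, [C i] is the kernel of [H_i(R/Q) -> H_i(P/Q)], [Y i] is the image of that
   map, and [X i] is the image of [H_i(P/Q) -> H_i(P/R)]. *)
pose C i := cap (kbounds n 0 i P Q) (kpart n 0 i R).
pose Y i := add (kcycles n 0 i R Q) (kbounds n 0 i P Q).
pose X i := add (kcycles n 0 i P Q) (kpart n 0 i R).
have BC i : {subset kbounds n 0 i R Q <= C i}.
  move=> _ /kboundsP[y [w [Ry Qw ->]]]; apply/capP; split.
    by apply/kboundsP; exists y, w; split=> //; apply: kpart_mono Ry.
  by rewrite rpredD ?kd_kpartS //; apply: kpart_mono Qw.
have CZ i : {subset C i <= kcycles n 0 i R Q}.
  by move=> x /capP[/(kbounds_cycles QP)/kcyclesP[_ Qdx] Rx]; apply/kcyclesP.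
have BX i : {subset kbounds n 0 i P R <= X i}.
  move=> _ /kboundsP[y [w [Py Rw ->]]]; rewrite rpredD //; last exact: sub_addr.
  by apply: sub_addl; apply: (kbounds_cycles QP); apply: kbounds_d.
have XZ i : {subset X i <= kcycles n 0 i P R}.
  apply: add_min => [x /kcyclesP[Px Qdx]|x Rx]; apply/kcyclesP; split=> //.
  - exact: kval_mono Qdx.
  - exact: kpart_mono Rx.
  - exact/kd_kval/(kpart_kval Rx).
have BY i : {subset kbounds n 0 i P Q <= Y i} by apply: sub_addr.
have YZ i : {subset Y i <= kcycles n 0 i P Q}.
  apply: add_min; last exact: kbounds_cycles.
  by move=> x /kcyclesP[Rx Qdx]; apply/kcyclesP; split=> //; apply: kpart_mono Rx.
have t1 i : (finlen qP (C i) (kcycles n 0 i R Q) <-> finlen qP (kbounds n 0 i P Q) (Y i)) /\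
    len qP (C i) (kcycles n 0 i R Q) = len qP (kbounds n 0 i P Q) (Y i).
  split; [apply: (finlen_transport (f := idfun) qP) | apply: (len_transport (f := idfun) qP)];
    rewrite //; try exact: sub_addl; try by move=> x /capP[].
  - by move=> x /kcyclesP[Rx _] Bx; apply/capP.
  - by move=> _ /addP[y [b [Zy Bb ->]]]; exists y => //=; rewrite addrC addKr.
  - by move=> x /kcyclesP[Rx _] Bx; apply/capP.
  - by move=> _ /addP[y [b [Zy Bb ->]]]; exists y => //=; rewrite addrC addKr.
have t2 i : (finlen qP (Y i) (kcycles n 0 i P Q) <-> finlen qP (kbounds n 0 i P R) (X i)) /\
    len qP (Y i) (kcycles n 0 i P Q) = len qP (kbounds n 0 i P R) (X i).
  have fB : {subset Y i <= kbounds n 0 i P R}.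
    apply: add_min => [x /kcyclesP[Rx _]|_ /kboundsP[y [w [Py Qw ->]]]].
      exact: kbounds_r.
    by apply/kboundsP; exists y, w; split=> //; apply: kpart_mono Qw.
  have fK x : x \in kcycles n 0 i P Q -> x \in kbounds n 0 i P R -> x \in Y i.
    move=> /kcyclesP[_ Qdx] /kboundsP[y [w [Py Rw xE]]]; rewrite xE addrC.
    apply/addP; exists w, (d y); split=> //; last exact: kbounds_d.
    by apply/kcyclesP; split=> //; move: Qdx; rewrite xE linearD /= kdd add0r.
  have fS y : y \in X i ->
      exists2 x, x \in kcycles n 0 i P Q & y - x \in kbounds n 0 i P R.
    case/addP => z [w [Zz Rw ->]]; exists z => //.
    by rewrite addrC addKr; apply: kbounds_r.
  have fZ x : x \in kcycles n 0 i P Q -> x \in X i by apply: sub_addl.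
  split; first exact: (finlen_transport (f := idfun) qP (YZ i) (BX i) fB fZ fK fS).
  exact: (len_transport (f := idfun) qP (YZ i) (BX i) fB fZ fK fS).
(* The connecting map, which is induced by [d] itself since everything lies in one complex. *)
have t3 i : len qP (X i.+1) (kcycles n 0 i.+1 P R) = len qP (kbounds n 0 i R Q) (C i).
  apply: (len_transport (f := d) qP); [exact: XZ | exact: BC | | | |].
  - move=> _ /addP[x [r [/kcyclesP[Px Qdx] Rr ->]]]; rewrite linearD rpredD //=.
      by apply: kbounds_r; apply: kpart_valued Qdx; apply: kd_kpartS Px.
    exact: kbounds_d.
  - move=> x /kcyclesP[Px Rdx]; apply/capP; split; first exact: kbounds_d.
    exact: kpart_valued (kd_kpartS Px) Rdx.
  - move=> x /kcyclesP[Px Rdx] /kboundsP[r [w [Rr Qw dxE]]].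
    apply/addP; exists (x - r), r; rewrite subrK; split=> //; apply/kcyclesP; split.
      by apply: submodB => //; apply: kpart_mono Rr.
    rewrite linearB /= dxE addrC addKr; exact: kpart_kval Qw.
  move=> _ /capP[/kboundsP[y [w [Py Qw ->]]] Rdyw]; exists y.
    apply/kcyclesP; split=> //; apply: (submodDr (y := w)).
      by apply: kval_mono QR (kpart_kval Qw).
    exact: kpart_kval Rdyw.
  by rewrite addrC addKr; apply: kbounds_r.
have l1 i := len_split (BC i) (CZ i) (fRQ i).
have l2 i := len_split (BX i) (XZ i) (fPR i).
have fY i : finlen qP (kbounds n 0 i P Q) (kcycles n 0 i P Q) /\
    klen n 0 i P Q = (len qP (kbounds n 0 i P Q) (Y i) + len qP (Y i) (kcycles n 0 i P Q))%N.
  have [_ f1 _] := l1 i; have [f2 _ _] := l2 i.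
  by apply: len_cat; [apply/(t1 i).1 | apply/(t2 i).1].
split; first by move=> i; case: (fY i).
pose e i := len qP (X i) (kcycles n 0 i P R).
have kE i : (klen n 0 i R Q + klen n 0 i P R)%N = (klen n 0 i P Q + (e i.+1 + e i))%N.
  have [_ _ E1] := l1 i; have [_ _ E2] := l2 i.
  rewrite (fY i).2 /klen E1 E2 (t1 i).2 (t2 i).2 /e (t3 i); lia.
have e0 : e 0%N = 0%N.
  rewrite /e; have [|_ //] := len_trivial (qP := qP) (XZ 0%N); move=> x /kcyclesP[Px _].
  apply: sub_sat; apply: sub_addl; apply/kcyclesP; split=> //.
  by rewrite (kpart_neg (kd_kpart Px)) rpred0.
have em : e m.+1 = 0%N.
  rewrite /e; have [|_ //] := len_trivial (qP := qP) (XZ m.+1).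
  move=> x /kcyclesP[/kpart_big-> _].
  by rewrite rpred0.
have := @alternating_telescope (fun i => (e i.+1)%:Z) (fun i => (e i.+1 + e i)%:Z) m.
rewrite e0 em addn0 mulr0 => /(_ erefl (fun i => PoszD _ _)) te.
rewrite -[LHS]addr0 -te /kchi -!big_split /=; apply: eq_bigr => i _.
by rewrite -!mulrDr -!PoszD kE.
Qed.

End KoszulInPlace.

(** * Splitting off the last generator: the Koszul complex as a mapping cone *)

Section KoszulPeel.
Context {A : comNzRingType} {m : nat} (u : 'I_m -> A) (M : lmodType A).
Implicit Types (P Q R : submodClosed M) (S T : {set 'I_m}).
Implicit Types (i e : nat).

Local Notation K := (@koszul A m M).
Local Notation d := (@koszul_d A m u M).
Implicit Types (x y z w : K).

Variables (n : nat) (nm : (n < m)%N).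
Let j := Ordinal nm.

(* Splitting off the last generator [e_j] of the subcomplex on [below n.+1]:
   [x = kzero x + kone x e_j] up to sign. *)
Definition kzero x : K := [ffun S : {set 'I_m} => if j \in S then 0 else x S].
Definition kone x : K := [ffun S : {set 'I_m} => if j \in S then 0 else x (j |: S)].
Definition kpair x y : K := [ffun S : {set 'I_m} => if j \in S then y (S :\ j) else x S].
(** For [S] below [n], this is the sign with which [d] removes [e_j] from [e_(j |: S)]: all the
    elements of [S] precede [j]. *)
Definition ksign x : K := [ffun S : {set 'I_m} => (-1) ^+ #|S| *: x S].

Fact kzero_linear : linear kzero.
Proof.
move=> a x y; apply/ffunP => S; rewrite !ffunE.
by case: ifP; rewrite ?scaler0 ?addr0.
Qed.
HB.instance Definition _ := GRing.isLinear.Build A K K *:%R kzero kzero_linear.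

Fact kone_linear : linear kone.
Proof.
move=> a x y; apply/ffunP => S; rewrite !ffunE.
by case: ifP; rewrite ?scaler0 ?addr0.
Qed.
HB.instance Definition _ := GRing.isLinear.Build A K K *:%R kone kone_linear.

Lemma kpairK x : kpair (kzero x) (kone x) = x.
Proof.
apply/ffunP => S; rewrite !ffunE; case: (boolP (j \in S)) => // jS.
by rewrite !finset.inE eqxx /= finset.setD1K.
Qed.

Definition klow x : Prop := forall S, j \in S -> x S = 0.

Lemma kpart_low e i P x : x \in kpart n e i P -> klow x.
Proof.
case/kpartP => _ x0 S jS; apply: x0; rewrite negb_and; apply/orP; right.
by apply/negP => /fintype.subsetP/(_ j jS); rewrite finset.inE ltnn.
Qed.

Lemma kzero_pair x y : klow x -> kzero (kpair x y) = x.
Proof.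
move=> x0; apply/ffunP => S; rewrite !ffunE; by case: (boolP (j \in S)) => // /x0.
Qed.

Lemma kone_pair x y : klow y -> kone (kpair x y) = y.
Proof.
move=> y0; apply/ffunP => S; rewrite !ffunE; case: (boolP (j \in S)) => [/y0//|jS].
by rewrite finset.setU11 finset.setU1K.
Qed.

Lemma kpair_linear a x y x' y' :
  a *: kpair x y + kpair x' y' = kpair (a *: x + x') (a *: y + y').
Proof. by apply/ffunP => S; rewrite !ffunE; case: ifP. Qed.

Lemma kpairD x y x' y' : kpair x y + kpair x' y' = kpair (x + x') (y + y').
Proof. by have := kpair_linear 1 x y x' y'; rewrite !scale1r. Qed.

Lemma kpair_kval P x y : x \in kval P -> y \in kval P -> kpair x y \in kval P.
Proof.
move=> /kvalP Px /kvalP Py; apply/kvalP => S; rewrite ffunE.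
by case: ifP.
Qed.

Lemma kzero_kval P x : x \in kval P -> kzero x \in kval P.
Proof.
move=> /kvalP Px; apply/kvalP => S; rewrite ffunE.
by case: ifP; rewrite ?rpred0.
Qed.

Lemma kone_kval P x : x \in kval P -> kone x \in kval P.
Proof.
move=> /kvalP Px; apply/kvalP => S; rewrite ffunE.
by case: ifP; rewrite ?rpred0.
Qed.

Lemma belowS S : j \notin S -> (S \subset @below m n.+1) = (S \subset @below m n).
Proof.
move=> jS; apply/fintype.subsetP/fintype.subsetP => Sn k kS; have := Sn k kS;
  rewrite !finset.inE ltnS; last exact: ltnW.
rewrite leq_eqVlt => /orP[/eqP kn|//]; case/negP: jS.
by have <- : k = j by apply: val_inj.
Qed.

Lemma belowS1 S : j \notin S -> (j |: S \subset @below m n.+1) = (S \subset @below m n).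
Proof.
by move=> jS; rewrite finset.subUset finset.sub1set finset.inE ltnSn belowS.
Qed.

Lemma kzero_kpart e i P x : x \in kpart n.+1 e i P -> kzero x \in kpart n e i P.
Proof.
move=> Px; apply/kpartP; split; first exact/kvalP/kzero_kval/(kpart_kval Px).
case/kpartP: Px => _ x0 S nS; rewrite ffunE; case: ifP => // /negbT jS.
by rewrite x0 // belowS.
Qed.

Lemma kone_kpart e i P x : x \in kpart n.+1 e i P -> kone x \in kpart n e.+1 i P.
Proof.
move=> Px; apply/kpartP; split; first exact/kvalP/kone_kval/(kpart_kval Px).
case/kpartP: Px => _ x0 S nS; rewrite ffunE; case: ifP => // /negbT jS.
by rewrite x0 // belowS1 // cardsU1 jS add1n addSnnS.
Qed.

Lemma kpair_kpart e i P x y :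
  x \in kpart n e i P -> y \in kpart n e.+1 i P -> kpair x y \in kpart n.+1 e i P.
Proof.
move=> Px Py; apply/kpartP; split.
  exact/kvalP/(kpair_kval (kpart_kval Px) (kpart_kval Py)).
move: Px Py => /kpartP[_ x0] /kpartP[_ y0] S nS; rewrite ffunE.
case: ifP => [jS|/negbT jS]; last by rewrite x0 // -belowS.
rewrite y0 //; apply: contra nS => /andP[/eqP cS Sn].
have := @belowS1 (S :\ j); rewrite finset.setD11 finset.setD1K // => -> //.
rewrite Sn andbT.
by rewrite [#|S|](cardsD1 j) jS add1n addSnnS cS.
Qed.

Lemma ksign_kval P x : x \in kval P -> ksign x \in kval P.
Proof. by move=> /kvalP Px; apply/kvalP => S; rewrite ffunE rpredZ. Qed.

Lemma ksign_kpart e i P x : x \in kpart n e i P -> ksign x \in kpart n e i P.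
Proof.
move=> /kpartP[Px x0]; apply/kpartP; split=> S; first by rewrite ffunE rpredZ.
by move=> nS; rewrite ffunE x0 ?scaler0.
Qed.

Lemma ksignK x : ksign (ksign x) = x.
Proof.
apply/ffunP => S; rewrite !ffunE scalerA -exprD addnn -mul2n exprM sqrrN expr1n.
by rewrite expr1n scale1r.
Qed.

Lemma kd_sign x : d (ksign x) = - ksign (d x).
Proof.
apply/ffunP => S; rewrite !ffunE scaler_sumr -sumrN; apply: eq_bigr => k kS.
rewrite !ffunE cardsU1 kS exprS !scalerA -scaleNr; congr (_ *: _); ring.
Qed.

(** The complex on [n.+1] generators is the mapping cone of multiplication by [u j], up to sign, on
    the complex on [n] generators. Of the two memberships only the support below [n] matters, whence
    the independent degrees. *)
Lemma kd_pair e i e' i' P P' x y : x \in kpart n e i P -> y \in kpart n e' i' P' ->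
  d (kpair x y) = kpair (d x + u j *: ksign y) (d y).
Proof.
move=> xn yn; have x0 := kpart_low xn; have y0 := kpart_low yn.
apply/ffunP => T; rewrite !ffunE; case: ifP => [jT|/negbT jT].
  have jD : j \notin T :\ j by rewrite finset.setD11.
  rewrite [RHS](bigD1 j) //= finset.setD1K // y0 // scaler0 add0r.
  apply: eq_big => [k|k kT].
    by rewrite !finset.inE negb_and negbK; case: eqP => [->|]; rewrite ?jT ?andbT.
  have kj : k != j by apply: contraNneq kT => ->.
  rewrite ffunE finset.inE jT orbT.
  have -> : (k |: T) :\ j = k |: (T :\ j).
    apply/finset.setP => l; rewrite !finset.inE; case: (eqVneq l j) => [->|] //=.
    by rewrite eq_sym (negPf kj).
  have [kn|nk] := ltnP k n.
    congr (_ ^+ _ * _ *: _); apply: eq_card => l; rewrite !finset.inE.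
    by case: (eqVneq l j) => [->|] //=; rewrite ltnNge (ltnW kn) andbF.
  case/kpartP: yn => _ ->; rewrite ?scaler0 //.
  rewrite negb_and; apply/orP; right; apply/negP => /fintype.subsetP/(_ k).
  by rewrite !finset.inE eqxx /= ltnNge nk => /(_ isT).
rewrite (bigD1 j) //= ffunE finset.setU11 finset.setU1K // addrC.
rewrite [in RHS](bigD1 j) //= [x (j |: T)]x0 ?finset.setU11 // scaler0 add0r.
congr (_ + _).
  apply: eq_bigr => k /andP[kT kj]; rewrite ffunE finset.inE (negPf jT) orbF.
  by rewrite finset.inE eq_sym (negPf kj).
(* If [T] is below [n], all of it precedes [j] and the sign is the one in [ksign]; otherwise [y T]
   is zero. *)
rewrite scalerA mulrC; case: (boolP (T \subset @below m n)) => [Tn|Tn].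
  congr (_ * _ ^+ _ *: _); apply: eq_card => l; rewrite finset.inE.
  case: (boolP (l \in T)) => //= lT.
  by have := fintype.subsetP Tn l lT; rewrite finset.inE.
by case/kpartP: yn => _ ->; rewrite ?scaler0 // (negPf Tn) andbF.
Qed.

Lemma kone_low x : klow x -> kone x = 0.
Proof.
move=> x0; apply/ffunP => S; rewrite !ffunE x0 ?finset.setU11 //.
by case: ifP.
Qed.

Lemma kzero_low x : klow x -> kzero x = x.
Proof.
by move=> x0; apply/ffunP => S; rewrite ffunE; case: (boolP (j \in S)) => // /x0.
Qed.

Lemma kzero_d e i P x : x \in kpart n.+1 e i P ->
  kzero (d x) = d (kzero x) + u j *: ksign (kone x).
Proof.
move=> Px; have P0 := kzero_kpart Px; have P1 := kone_kpart Px.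
rewrite -{1}[x]kpairK (kd_pair P0 P1) kzero_pair //.
apply: (kpart_low (e := e.+1) (i := i) (P := P)).
by rewrite rpredD ?(kd_kpart _ P0) // rpredZ // ksign_kpart.
Qed.

Lemma kone_d e i P x : x \in kpart n.+1 e i P -> kone (d x) = d (kone x).
Proof.
move=> Px; have P0 := kzero_kpart Px; have P1 := kone_kpart Px.
rewrite -{1}[x]kpairK (kd_pair P0 P1) kone_pair //.
exact: kpart_low (kd_kpart _ P1).
Qed.

Lemma kpartS e i P x : x \in kpart n e i P -> x \in kpart n.+1 e i P.
Proof.
move=> Px; have x0 := kpart_low Px.
rewrite -[x]kpairK kzero_low // kone_low //.
by apply: kpair_kpart; rewrite ?rpred0.
Qed.

Context (q : ideal A) (qP : prime_ideal q).

Lemma kcycles_shift i P Q : kcycles u n 1 i.+1 P Q =i kcycles u n 0 i P Q.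
Proof. by move=> x; apply/kcyclesP/kcyclesP; rewrite kpart_shift. Qed.

Lemma kbounds_shift i P Q : kbounds u n 1 i.+1 P Q =i kbounds u n 0 i P Q.
Proof.
by move=> x; apply/kboundsP/kboundsP => -[y [w [Py Qw ->]]]; exists y, w;
  move: Py Qw; rewrite !kpart_shift.
Qed.

Lemma klen_shift P Q : {subset Q <= P} -> kfin u qP n 0 P Q ->
  [/\ kfin u qP n 1 P Q, klen u qP n 1 0 P Q = 0%N &
      forall i, klen u qP n 1 i.+1 P Q = klen u qP n 0 i P Q].
Proof.
move=> QP fPQ; have E i := len_eq qP (@kbounds_shift i P Q) (@kcycles_shift i P Q).
have [|f0 l0] := len_trivial (qP := qP) (@kbounds_cycles _ _ u _ n 1 0 _ _ QP).
  by move=> x /kcyclesP[/kpart_neg-> _]; rewrite rpred0.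
split=> // [[|i]|i]; [exact: f0 | exact/(E i).1 | exact: (E i).2].
Qed.

(** The map of which the complex is the cone is zero on [P / Q], so [H_i] on [n.+1] generators has
    the length of [H_i] plus that of [H_(i-1)] on [n] generators. The alternating sum telescopes to
    the length of [H_m] on [n] generators, which is zero as [n < m]. *)
Lemma kchi_killed P Q : {subset Q <= P} -> (forall x : M, x \in P -> u j *: x \in Q) ->
    kfin u qP n 0 P Q ->
  kfin u qP n.+1 0 P Q /\ kchi u qP n.+1 P Q = 0.
Proof.
move=> QP uPQ fPQ; have [fPQ1 l10 l1S] := klen_shift QP fPQ.
have uK x : x \in kval P -> u j *: x \in kval Q.
  by move=> /kvalP Px; apply/kvalP => S; rewrite ffunE uPQ.
have uKs e i x : x \in kpart n e i P -> u j *: ksign x \in kpart n e i Q.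
  move=> Px; apply: (kpart_valued (P := P)); first by rewrite rpredZ ?(ksign_kpart Px).
  exact: uK (kpart_kval (ksign_kpart Px)).
pose Y i := add (kcycles u n 0 i P Q) (kbounds u n.+1 0 i P Q).
have ZZ i : {subset kcycles u n 0 i P Q <= kcycles u n.+1 0 i P Q}.
  by move=> x /kcyclesP[Px Qdx]; apply/kcyclesP; split=> //; apply: kpartS.
have BY i : {subset kbounds u n.+1 0 i P Q <= Y i} by apply: sub_addr.
have YZ i : {subset Y i <= kcycles u n.+1 0 i P Q}.
  by apply: add_min; [apply: ZZ | apply: kbounds_cycles].
have BZ e i := @kbounds_cycles _ _ u _ n e i _ _ QP.
have t1 i : (finlen qP (kbounds u n 0 i P Q) (kcycles u n 0 i P Q) <->
      finlen qP (kbounds u n.+1 0 i P Q) (Y i)) /\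
    len qP (kbounds u n 0 i P Q) (kcycles u n 0 i P Q) = len qP (kbounds u n.+1 0 i P Q) (Y i).
  have fB x : x \in kbounds u n 0 i P Q -> x \in kbounds u n.+1 0 i P Q.
    move=> /kboundsP[y [w [Py Qw ->]]]; apply/kboundsP; exists y, w.
    by split=> //; apply: kpartS.
  have fZ x : x \in kcycles u n 0 i P Q -> x \in Y i by apply: sub_addl.
  have fK x : x \in kcycles u n 0 i P Q -> x \in kbounds u n.+1 0 i P Q ->
      x \in kbounds u n 0 i P Q.
    move=> /kcyclesP[Px _] /kboundsP[y [w [Py Qw xE]]].
    rewrite -(kzero_low (kpart_low Px)) xE linearD /= (kzero_d Py) -addrA.
    apply/kboundsP; exists (kzero y), (u j *: ksign (kone y) + kzero w).
    split=> //; first exact: kzero_kpart.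
    rewrite rpredD ?(kzero_kpart Qw) //; apply: uKs.
    by rewrite -kpart_shift; apply: kone_kpart.
  have fS y : y \in Y i ->
      exists2 x, x \in kcycles u n 0 i P Q & y - x \in kbounds u n.+1 0 i P Q.
    by case/addP => z [b [Zz Bb ->]]; exists z => //; rewrite addrC addKr.
  split; first exact: (finlen_transport (f := idfun) qP (BZ 0%N i) (BY i) fB fZ fK fS).
  exact: (len_transport (f := idfun) qP (BZ 0%N i) (BY i) fB fZ fK fS).
have t2 i : (finlen qP (Y i) (kcycles u n.+1 0 i P Q) <->
      finlen qP (kbounds u n 1 i P Q) (kcycles u n 1 i P Q)) /\
    len qP (Y i) (kcycles u n.+1 0 i P Q) = len qP (kbounds u n 1 i P Q) (kcycles u n 1 i P Q).
  have fB x : x \in Y i -> kone x \in kbounds u n 1 i P Q.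
    move=> /addP[z [_ [/kcyclesP[Pz _] /kboundsP[y [w [Py Qw ->]]] ->]]].
    rewrite linearD /= (kone_low (kpart_low Pz)) add0r linearD /= (kone_d Py).
    apply/kboundsP; exists (kone y), (kone w).
    by split=> //; apply: kone_kpart.
  have fZ x : x \in kcycles u n.+1 0 i P Q -> kone x \in kcycles u n 1 i P Q.
    move=> /kcyclesP[Px Qdx]; apply/kcyclesP; split; first exact: kone_kpart.
    by rewrite -(kone_d Px) kone_kval.
  have fK z : z \in kcycles u n.+1 0 i P Q -> kone z \in kbounds u n 1 i P Q -> z \in Y i.
    move=> /kcyclesP[Pz Qdz] /kboundsP[y [w [Py Qw zE]]].
    have Py0 : y \in kpart n 0 i P by rewrite -kpart_shift.
    (* The boundary of [kpair 0 y] has the extra first component [u j *: ksign y]. It takes values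
       in [Q], because [u j] kills [P / Q], and may therefore be cancelled inside the boundaries. *)
    apply/addP; exists (kzero z), (d (kpair 0 y) + kpair (- (u j *: ksign y)) w); split.
    - apply/kcyclesP; split; first exact: kzero_kpart.
      have := kzero_kval Qdz; rewrite (kzero_d Pz); apply: submodDr.
      exact/uK/ksign_kval/(kpart_kval (kone_kpart Pz)).
    - apply/kboundsP; exists (kpair 0 y), (kpair (- (u j *: ksign y)) w).
      split=> //; first by apply: kpair_kpart; rewrite ?rpred0.
      by apply: kpair_kpart => //; apply/submodN/uKs.
    rewrite (kd_pair (rpred0 (kpart n 1 i.+1 P)) Py) linear0 add0r kpairD subrr.
    rewrite -zE -{1}[kzero z]addr0 -[X in X + kpair _ _]kpairK kzero_low; last first.
      by rewrite addr0; apply: kpart_low (kzero_kpart Pz).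
    rewrite kone_low; last by rewrite addr0; apply: kpart_low (kzero_kpart Pz).
    by rewrite kpairD !addr0 add0r kpairK.
  have fS y : y \in kcycles u n 1 i P Q ->
      exists2 x, x \in kcycles u n.+1 0 i P Q & y - kone x \in kbounds u n 1 i P Q.
    move=> /kcyclesP[Py Qdy]; exists (kpair 0 y); last first.
      by rewrite kone_pair ?subrr ?rpred0 //; apply: kpart_low Py.
    apply/kcyclesP; split; first by apply: kpair_kpart; rewrite ?rpred0.
    rewrite (kd_pair (rpred0 (kpart n 1 i.+1 P)) Py) linear0 add0r kpair_kval //.
    exact/uK/ksign_kval/(kpart_kval Py).
  split; first exact: (finlen_transport (f := kone) qP (YZ i) (BZ 1%N i) fB fZ fK fS).
  exact: (len_transport (f := kone) qP (YZ i) (BZ 1%N i) fB fZ fK fS).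
have fY i : finlen qP (kbounds u n.+1 0 i P Q) (kcycles u n.+1 0 i P Q) /\
    klen u qP n.+1 0 i P Q = (klen u qP n 0 i P Q + klen u qP n 1 i P Q)%N.
  by rewrite /klen (t1 i).2 -(t2 i).2; apply: len_cat; [apply/(t1 i).1 | apply/(t2 i).1].
split; first by move=> i; case: (fY i).
rewrite /kchi (@alternating_telescope (fun i => (klen u qP n 0 i P Q)%:Z)
  (fun i => (klen u qP n.+1 0 i P Q)%:Z)).
- have [|_] := len_trivial (qP := qP) (BZ 0%N m).
    by move=> x /kcyclesP[/(kpart_top nm)-> _]; rewrite rpred0.
  by rewrite -/(klen u qP n 0 m P Q) => ->; rewrite mulr0.
- by rewrite (fY 0%N).2 l10 addn0.
by move=> i; rewrite (fY i.+1).2 l1S PoszD.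
Qed.

(** For [u j] regular on [P / Q], the cone computes the homology of the cokernel: [kzero] induces an
    isomorphism from [H_i] on [n.+1] generators of [P / Q] to [H_i] on [n] generators of
    [P / (Q + u_j P)]. *)
Lemma kchi_regular P Q : {subset Q <= P} ->
    (forall x : M, x \in P -> u j *: x \in Q -> x \in Q) ->
    kfin u qP n 0 P (add Q (img (scale_by (u j)) P)) ->
  kfin u qP n.+1 0 P Q /\
  kchi u qP n.+1 P Q = kchi u qP n P (add Q (img (scale_by (u j)) P)).
Proof.
set Q' := add _ _ => QP reg fPQ.
have QQ' : {subset Q <= Q'} by apply: sub_addl.
have uQ' (x : M) : x \in P -> u j *: x \in Q'.
  by move=> Px; apply: sub_addr; apply/imgP; exists x.
have Q'P : {subset Q' <= P}.
  by apply: add_min => // _ /imgP[x Px ->]; rewrite rpredZ.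
have kreg x : x \in kval P -> u j *: x \in kval Q -> x \in kval Q.
  move=> /kvalP Px /kvalP Qux; apply/kvalP => S; apply: reg => //.
  by have := Qux S; rewrite ffunE.
have kuQ' e i x : x \in kpart n e i P -> u j *: x \in kpart n e i Q'.
  move=> Px; apply: (kpart_valued (P := P)); first by rewrite rpredZ ?Px.
  by apply/kvalP => S; rewrite ffunE uQ' //; apply/kvalP/(kpart_kval Px).
have split_Q' e i x : x \in kpart n e i Q' ->
    exists w y, [/\ w \in kpart n e i Q, y \in kpart n e i P & x = w + u j *: y].
  move=> /kpartP[Q'x x0].
  (* The decomposition is chosen coefficientwise; the last clause makes both parts vanish where [x]
     does, so that they stay in the same [kpart]. *)
  have /choice[f fP] : forall S, exists p : M * M, [/\ p.1 \in Q, p.2 \in P,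
      x S = p.1 + u j *: p.2 & x S = 0 -> p = (0, 0)].
    move=> S; case: (eqVneq (x S) 0) => [xS|xS].
      by exists (0, 0); rewrite /= !rpred0 scaler0 addr0 xS.
    have /addP[w [_ [Qw /imgP[y Py ->] xE]]] := Q'x S.
    by exists (w, y); split=> // /eqP; rewrite (negPf xS).
  exists [ffun S => (f S).1], [ffun S => (f S).2]; split.
  - apply/kpartP; split=> S; first by rewrite ffunE; case: (fP S).
    by move=> /x0 xS; rewrite ffunE; have [_ _ _ ->] := fP S.
  - apply/kpartP; split=> S; first by rewrite ffunE; case: (fP S).
    by move=> /x0 xS; rewrite ffunE; have [_ _ _ ->] := fP S.
  by apply/ffunP => S; rewrite !ffunE; case: (fP S).
clearbody Q'.
have t i : (finlen qP (kbounds u n.+1 0 i P Q) (kcycles u n.+1 0 i P Q) <->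
      finlen qP (kbounds u n 0 i P Q') (kcycles u n 0 i P Q')) /\
    klen u qP n.+1 0 i P Q = klen u qP n 0 i P Q'.
  have fB x : x \in kbounds u n.+1 0 i P Q -> kzero x \in kbounds u n 0 i P Q'.
    move=> /kboundsP[y [w [Py Qw ->]]]; rewrite linearD /= (kzero_d Py) -addrA.
    apply/kboundsP; exists (kzero y), (u j *: ksign (kone y) + kzero w).
    split=> //; first exact: kzero_kpart.
    rewrite rpredD ?(kpart_mono QQ' (kzero_kpart Qw)) //; apply/kuQ'/ksign_kpart.
    by rewrite -kpart_shift; apply: kone_kpart.
  have fZ z : z \in kcycles u n.+1 0 i P Q -> kzero z \in kcycles u n 0 i P Q'.
    move=> /kcyclesP[Pz Qdz]; apply/kcyclesP; split; first exact: kzero_kpart.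
    have := kval_mono QQ' (kzero_kval Qdz); rewrite (kzero_d Pz); apply: submodDr.
    exact/(kpart_kval (kuQ' _ _ _ (ksign_kpart (kone_kpart Pz)))).
  have fK z : z \in kcycles u n.+1 0 i P Q -> kzero z \in kbounds u n 0 i P Q' ->
      z \in kbounds u n.+1 0 i P Q.
    move=> /kcyclesP[Pz Qdz] /kboundsP[y [w' [Py Qw' zE]]].
    have [w [v [Qw Pv w'E]]] := split_Q' _ _ _ Qw'.
    pose v' := ksign v.
    have Pv' : v' \in kpart n 1 i.+1 P by rewrite kpart_shift ksign_kpart.
    (* The sign in [v'] makes the cone term of [d (kpair y v')] equal to [u j *: v]. The remainder
       [kone z - d v'] has values in [Q] by regularity: the first component of the cycle condition
       on [z] bounds its multiple by [u j]. *)
    apply/kboundsP; exists (kpair y v'), (kpair w (kone z - d v')); split.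
    - exact: kpair_kpart.
    - apply: kpair_kpart => //; apply: (kpart_valued (P := P)).
        by rewrite submodB ?(kone_kpart Pz) // kd_kpartS.
      rewrite -[_ - _]ksignK; apply: ksign_kval; apply: kreg.
        apply: ksign_kval; apply: submodB; first exact: kpart_kval (kone_kpart Pz).
        exact/kd_kval/(kpart_kval Pv').
      have := kzero_kval Qdz; rewrite (kzero_d Pz) zE w'E !linearD /= kdd add0r.
      rewrite -addrA => /(submodDl (kd_kval u (kpart_kval Qw))).
      rewrite linearZ /= -scalerDr -{1}[v]ksignK kd_sign.
      have -> // : - ksign (d v') + ksign (kone z) = ksign (kone z - d v').
      by apply/ffunP => S; rewrite !ffunE scalerBr addrC.
    rewrite (kd_pair Py Pv') ksignK kpairD -[LHS]kpairK zE w'E; congr kpair.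
      by rewrite -!addrA [w + _]addrC.
    by rewrite addrC subrK.
  have fS x : x \in kcycles u n 0 i P Q' ->
      exists2 z, z \in kcycles u n.+1 0 i P Q & x - kzero z \in kbounds u n 0 i P Q'.
    move=> /kcyclesP[Px Q'dx].
    have [w [y [Qw Py dxE]]] := split_Q' _ _ _ (kpart_valued (kd_kpart u Px) Q'dx).
    have Psy := ksign_kpart Py.
    (* With [d x = w + u j *: y], the second component is chosen to cancel [u j *: y]. Its own
       differential is in [Q] by regularity, since [d (d x) = 0] puts [u j *: d y] in [Q]. *)
    exists (kpair x (- ksign y)); last first.
      by rewrite kzero_pair ?subrr ?rpred0 //; apply: kpart_low Px.
    apply/kcyclesP; split; first by apply: kpair_kpart => //; apply: submodN.
    rewrite (kd_pair Px (submodN Psy)); apply: kpair_kval.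
      rewrite dxE; have -> : ksign (- ksign y) = - y.
        rewrite -{2}[y]ksignK; apply/ffunP => S; rewrite !ffunE.
        by rewrite scalerN.
      by rewrite scalerN addrK (kpart_kval Qw).
    have -> : d (- ksign y) = ksign (d y) by rewrite linearN /= kd_sign opprK.
    apply: ksign_kval; apply: kreg; first exact/kd_kval/(kpart_kval Py).
    have := kdd u x; rewrite dxE linearD linearZZ => /eqP.
    rewrite addrC addr_eq0 => /eqP->.
    exact/submodN/kd_kval/(kpart_kval Qw).
  have B1 := @kbounds_cycles _ _ u _ n.+1 0 i _ _ QP.
  have B2 := @kbounds_cycles _ _ u _ n 0 i _ _ Q'P.
  split; first exact: (finlen_transport (f := kzero) qP B1 B2 fB fZ fK fS).
  exact: (len_transport (f := kzero) qP B1 B2 fB fZ fK fS).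
split; first by move=> i; apply/(t i).1.
by apply: eq_bigr => i _; rewrite (t i).2.
Qed.

End KoszulPeel.

(** * Vanishing of the Euler characteristic *)

Section Vanishing.
Context {A : comNzRingType} (noeA : noetherian_ring A) {m : nat} (u : 'I_m -> A).
Context (M : lmodType A) (accM : acc M) (q : ideal A) (qP : prime_ideal q).
Implicit Types (P Q R : submodClosed M) (n i : nat).

Fact colon_proof Q P :
  prop_submod (fun a : A^o => forall x, x \in P -> (a : A) *: x \in Q).
Proof.
split=> [x _|a b c Qb Qc x Px]; first by rewrite (scale0r x) rpred0.
by rewrite scalerDl -scalerA rpredD ?Qc // rpredZ ?Qb.
Qed.
Definition colon Q P : ideal A := mksub (colon_proof Q P).
Lemma colonP Q P (a : A) :
  reflect (forall x, x \in P -> a *: x \in Q) ((a : A^o) \in colon Q P).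
Proof. exact: mksubP. Qed.

Definition first_gens n : ideal A :=
  submod_gen [set a : A^o | exists2 k : 'I_m, (k < n)%N & u k = a]%classic.

(** After localization at [q], this says that [q] is nil modulo the first [n] generators and the
    annihilator of [P / Q]. Since [P] and [Q] enter only through [colon Q P], subquotients inherit
    it. *)
Definition supported n Q P : Prop := forall a : A, a \in q ->
  exists2 s : A, s \notin q & exists k, (s * a ^+ k : A^o) \in add (first_gens n) (colon Q P).

(** The last generator kills [P1 / Q1], so it can be moved from [first_gens] into the colon
    ideal. *)
Lemma supportedS n (nm : (n < m)%N) Q P Q1 P1 : supported n.+1 Q P ->
    {subset colon Q P <= colon Q1 P1} -> (u (Ordinal nm) : A^o) \in colon Q1 P1 ->
  supported n Q1 P1.
Proof.
move=> sQP colS ucol a qa; have [s sq [k sk]] := sQP a qa.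
exists s => //; exists k; apply: add_min sk => [x|x /colS]; last exact: sub_addr.
apply: submod_gen_min => _ [l ln <-].
move: ln; rewrite ltnS leq_eqVlt => /orP[/eqP ln|ln].
  by apply: sub_addr; have -> : l = Ordinal nm by apply: val_inj.
by apply/sub_addl/submod_genP; exists l.
Qed.

Lemma kfin_refl n Q : kfin u qP n 0 Q Q /\ kchi u qP n Q Q = 0.
Proof.
have E i : finlen qP (kbounds u n 0 i Q Q) (kcycles u n 0 i Q Q) /\ klen u qP n 0 i Q Q = 0%N.
  apply: len_trivial; first exact: kbounds_cycles.
  by move=> x /kcyclesP[Qx _]; apply: sub_sat; apply: kbounds_r.
split=> [i|]; first by case: (E i).
by rewrite /kchi big1 // => i _; rewrite (E i).2 mulr0.
Qed.

Lemma kpart0 e i P (x : @koszul A m M) : x \in kpart 0 e (e + i.+1) P -> x = 0.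
Proof.
case/kpartP => _ x0; apply/ffunP => S; rewrite ffunE x0 // addnC eqn_add2l.
case: (boolP (S \subset below 0)) => [/fintype.subsetP S0|]; last by rewrite andbF.
suff -> : S = finset.set0 by rewrite cards0.
by apply/eqP; rewrite -finset.subset0; apply/fintype.subsetP => k /S0; rewrite !finset.inE.
Qed.

Definition at_set0 (x : @koszul A m M) : M := x finset.set0.

Fact at_set0_linear : linear at_set0.
Proof. by move=> a x y; rewrite /at_set0 !ffunE. Qed.
HB.instance Definition _ :=
  GRing.isLinear.Build A (@koszul A m M) M *:%R at_set0 at_set0_linear.

(** Without generators only the coefficient at the empty set is left: [H_0] is [P / Q] and the other
    homology vanishes. *)
Lemma kfin0 Q P : {subset Q <= P} -> finlen qP Q P -> kfin u qP 0 0 P Q.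
Proof.
move=> QP fQP [|i]; last first.
  have [|f0 _] := len_trivial (qP := qP) (@kbounds_cycles _ _ u _ 0 0 i.+1 P Q QP); last by [].
  by move=> x /kcyclesP[/(@kpart0 0)-> _]; rewrite rpred0.
have BZ := @kbounds_cycles _ _ u _ 0 0 0 P Q QP.
apply/(finlen_transport (f := at_set0) qP BZ QP) => //.
- move=> _ /kboundsP[y [w [/(@kpart0 0)-> Qw ->]]]; rewrite linear0 add0r.
  exact/kvalP/(kpart_kval Qw).
- by move=> x /kcyclesP[Px _]; apply/kvalP/(kpart_kval Px).
- move=> x /kcyclesP[/kpartP[Px x0] _] Qx0; apply: kbounds_r; apply/kpartP; split=> // S.
  case: (eqVneq S finset.set0) => [->//|S0]; rewrite x0 ?rpred0 //.
  by rewrite addn0 cards_eq0 (negPf S0).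
move=> y Py; pose x : @koszul A m M := [ffun S : {set 'I_m} =>
  if S == finset.set0 then y else 0].
have Px : x \in kpart 0 0 0 P.
  apply/kpartP; split=> S; first by rewrite ffunE; case: ifP; rewrite ?rpred0.
  rewrite addn0 cards_eq0 ffunE; case: eqP => [->|//].
  by rewrite finset.sub0set.
have : y - at_set0 x \in Q by rewrite /at_set0 ffunE eqxx subrr rpred0.
exists x => //; apply/kcyclesP; split=> //.
by rewrite (kpart_neg (kd_kpart u Px)) rpred0.
Qed.

(* The hypothesis on chains says that the localization of [P / Q] at [q] has
   dimension [< n].  In the induction step, [R] is maximal with [R / Q] of
   characteristic 0; this makes [u_n] regular on [P / R]. *)
Lemma kchi_vanish n P Q : (n <= m)%N -> {subset Q <= P} -> supported n Q P ->
  kfin u qP n 0 P Q /\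
  ((forall p : ideal A, {subset colon Q P <= p} -> ~ prime_chain_over q n p) ->
    kchi u qP n P Q = 0).
Proof.
elim: n P Q => [|n IH] P Q nm QP sQP.
  split.
    apply: kfin0 => //; apply: (finlen_torsion noeA) => // a /sQP[s sq [k sk]].
    exists s => //; exists k; apply/colonP; apply: add_min sk => // x.
    by apply: submod_gen_min => y [].
  (* A chain of zero steps over [q] can consist of [q] alone, so the hypothesis says that [q] does
     not contain the annihilator of [P / Q]: the localization, and all its homology, is zero. *)
  move=> /(_ q) nc; have [s scol sq] : exists2 s : A, (s : A^o) \in colon Q P & s \notin q.
    apply: contrapT => ns; apply: nc; last by split.
    move=> a ca; apply: contrapT => /negP aq.
    by apply: ns; exists a.
  rewrite /kchi big1 // => i _.
  have [|_] := len_trivial (qP := qP) (@kbounds_cycles _ _ u _ 0 0 i P Q QP).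
    move=> x /kcyclesP[/kpartP[Px x0] _]; apply/satP; exists s => //.
    apply: kbounds_r; apply/kpartP; split=> S.
      by rewrite ffunE; apply: (colonP _ _ _ scol).
    by move=> nS; rewrite ffunE x0 // scaler0.
  by rewrite -/(klen u qP 0 0 i P Q) => ->; rewrite mulr0.
pose j := Ordinal nm.
have [|R [QR RP fRQ cRQ] Rmax] := acc_max (P := fun R =>
   [/\ {subset Q <= R}, {subset R <= P}, kfin u qP n.+1 0 R Q & kchi u qP n.+1 R Q = 0])
   (X0 := Q) accM.
  by have [? ?] := kfin_refl n.+1 Q; split.
have colQR : {subset colon Q P <= colon R P}.
  by move=> a /colonP ca; apply/colonP => x /ca/QR.
(* Let [R'] consist of the elements of [P] sent into [R] by [u j]. As [u j] kills [R' / R], its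
   characteristic is 0, and by additivity so is that of [R' / Q]; maximality of [R] gives
   [R' = R]. *)
have reg x : x \in P -> u j *: x \in R -> x \in R.
  pose R' := cap P (pre (scale_by (u j)) R).
  move=> Px Rux; apply: (Rmax R'); last first.
  - by apply/capP; split=> //; apply/preP.
  - by move=> y Ry; apply/capP; split; [apply: RP | apply/preP; rewrite rpredZ].
  have RR' : {subset R <= R'}.
    by move=> y Ry; apply/capP; split; [apply: RP | apply/preP/rpredZ].
  have uR' y : y \in R' -> u j *: y \in R by case/capP => _ /preP.
  have R'P : {subset R' <= P} by move=> y /capP[].
  have [|||f1 _] := IH R' R; rewrite ?(ltnW nm) //.
    apply: (supportedS (nm := nm) sQP); last by apply/colonP.
    by move=> a /colQR/colonP ca; apply/colonP => y /R'P/ca.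
  have [f2 c2] := kchi_killed RR' uR' f1.
  have [f3 c3] := kchi_add QR RR' fRQ f2.
  by split=> // [y /QR/RR'//|]; rewrite c3 cRQ c2 addr0.
pose Q' := add R (img (scale_by (u j)) P).
have uQ' x : x \in P -> u j *: x \in Q'.
  by move=> Px; apply: sub_addr; apply/imgP; exists x.
have RQ' : {subset R <= Q'} by apply: sub_addl.
have [|||f1 c1] := IH P Q'; rewrite ?(ltnW nm) //.
- by apply: add_min => // _ /imgP[x Px ->]; apply: rpredZ.
- apply: (supportedS (nm := nm) sQP); last by apply/colonP.
  by move=> a /colQR/colonP ca; apply/colonP => x /ca/RQ'.
have [f2 c2] := kchi_regular RP reg f1.
have [f3 c3] := kchi_add QR RP fRQ f2.
split=> // nc; rewrite c3 cRQ c2 add0r; apply: c1 => p cp cn.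
have pP := prime_chain_overS cn.
(* The dimension drops with [P / (R + u_j P)]: a chain starting at [p] extends downwards to a prime
   [p0] that avoids all [s * u j ^+ k] with [s] outside [p]. It exists because [u j] is regular on
   [P / R]: if [s * u j ^+ k] sends [P] into [R], so does [s], whence [s] is in [p]. The inclusion
   in [p] is strict since [u j] is in [p] but not in [p0]. *)
have [||a|p0 [p0P Rp0 p0S]] := prime_disjoint noeA (J := colon R P)
    (S := fun c => exists s k, s \notin p /\ c = s * u j ^+ k).
- by exists 1, 0%N; rewrite expr0 mulr1; split=> //; apply: prime1.
- move=> _ _ [s [k [sp ->]]] [t [l [tp ->]]]; exists (s * t), (k + l)%N.
  by split; [apply: primeM | rewrite exprD mulrACA].
- move=> ca [s [k [/negP sp aE]]]; apply: sp; apply: cp; apply/colonP => x Px.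
  apply: RQ'; move: ca => /colonP/(_ x Px); rewrite {}aE.
  elim: k => [|k IHk]; first by rewrite expr0 mulr1.
  rewrite exprS mulrCA -scalerA => Ru; apply: IHk; apply: reg Ru.
  by rewrite rpredZ.
apply: (nc p0); first by move=> a /colQR/Rp0.
split=> //; exists p; split=> //.
- move=> a p0a; apply: contrapT => /negP ap; apply: (p0S a p0a).
  by exists a, 0%N; rewrite expr0 mulr1.
move=> /(_ (u j)) up0; apply: (p0S (u j)).
  by apply/up0/cp/colonP.
by exists 1, 1%N; rewrite expr1 mul1r; split=> //; apply: prime1.
Qed.

End Vanishing.

(** * Lengths and dimensions of quotients *)

Section NatSup.
Local Open Scope classical_set_scope.
Local Open Scope ereal_scope.
Implicit Types (P : set nat) (n k : nat).

Lemma nat_supE P x : P !=set0 ->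
  ubound [set k%:Z%:E | k in P] x -> lbound (ubound [set k%:Z%:E | k in P]) x ->
  nat_sup P = x.
Proof.
move=> [n Pn] ubx lbx; rewrite /nat_sup /supremum ifN; last first.
  by apply/set0P; exists (n%:Z%:E); exists n.
apply: xget_unique; first by split.
by move=> y [uby lby]; apply/eqP; rewrite eq_le lbx // lby.
Qed.

Lemma nat_sup_max P n : P n -> (forall k, P k -> (k <= n)%N) -> nat_sup P = n%:Z%:E.
Proof.
move=> Pn nmax; apply: nat_supE; first by exists n.
  by move=> _ [k /nmax kn <-]; rewrite lee_fin lez_nat.
by move=> y; apply; exists n.
Qed.

Lemma nat_sup_unbounded P : (forall n, exists2 k, (n <= k)%N & P k) -> nat_sup P = +oo.
Proof.
move=> ubP; apply: nat_supE; first by have [k _ Pk] := ubP 0%N; exists k.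
  by move=> _ [k _ <-]; rewrite leey.
case=> [z||] zub //; last first.
  by have [k _ Pk] := ubP 0%N; have := zub _ (ex_intro2 _ _ k Pk erefl).
have [k zk Pk] := ubP `|z|%N.+1; have := zub _ (ex_intro2 _ _ k Pk erefl).
rewrite lee_fin leNgt => /negP[]; apply: le_lt_trans (ler_norm z) _.
by rewrite -abszE ltz_nat.
Qed.

Lemma nat_sup_cases P : [\/ (forall n, ~ P n) /\ nat_sup P = -oo,
  exists n, [/\ P n, forall k, P k -> (k <= n)%N & nat_sup P = n%:Z%:E] | nat_sup P = +oo].
Proof.
have [[n0 Pn0]|nP] := pselect (P !=set0); last first.
  constructor 1; split; first by move=> n Pn; apply: nP; exists n.
  rewrite /nat_sup (_ : P = set0) ?image_set0 ?supremum0 //.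
  by apply/seteqP; split=> // n Pn; apply: nP; exists n.
have [ubP|] := pselect (forall n, exists2 k, (n <= k)%N & P k).
  by constructor 3; apply: nat_sup_unbounded.
move=> /existsNP[n nub]; constructor 2.
have exP : exists k, `[< P k >] by exists n0; apply/asboolP.
have ubP k : `[< P k >] -> (k <= n)%N.
  move=> /asboolP Pk; rewrite leqNgt; apply/negP => nk.
  by apply: nub; exists k => //; apply: ltnW.
case: (ex_maxnP exP ubP) => k /asboolP Pk kmax.
have {}kmax l : P l -> (l <= k)%N by move=> Pl; apply: kmax; apply/asboolP.
by exists k; split=> //; apply: nat_sup_max.
Qed.

Lemma nat_sup_ge P n : P n -> n%:Z%:E <= nat_sup P.
Proof.
move=> Pn; have [[/(_ n)]//|[k [Pk kmax ->]]|->] := nat_sup_cases P; last by rewrite leey.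
by rewrite lee_fin lez_nat kmax.
Qed.

Lemma nat_sup_attained P n : nat_sup P = n%:Z%:E -> P n.
Proof.
have [[_ ->]|[k [Pk _ ->]]|->] := nat_sup_cases P; rewrite //=.
by case=> <-.
Qed.

Lemma nat_sup_bounded P : nat_sup P < +oo -> exists n, ~ P n.
Proof.
have [[nP _] _|[k [_ kmax _]] _|->] := nat_sup_cases P; last by rewrite ltxx.
  by exists 0%N.
by exists k.+1 => /kmax; rewrite ltnn.
Qed.

End NatSup.

(** * Lengths of quotient modules as lengths of chains between submodules *)

Section Quotients.

Section Pi.
Context {R : pzRingType} {V : lmodType R} (N : submodClosed V).

Definition qproj (x : V) : quot N := (\pi_(quot N) x)%qT.

Fact qproj_linear : linear qproj.
Proof. by move=> a x y; rewrite /qproj !piE. Qed.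
HB.instance Definition _ := GRing.isLinear.Build R V (quot N) *:%R qproj qproj_linear.

Lemma qproj0 x : reflect (qproj x = 0) (x \in N).
Proof.
have -> : (0 : quot N) = qproj 0 by rewrite linear0.
by rewrite -[x in x \in N]subr0; apply: quot_eqP.
Qed.

Lemma qproj_surj (y : quot N) : exists x, qproj x = y.
Proof. by exists (repr y); rewrite /qproj reprK. Qed.

End Pi.

Context {A : comNzRingType} (q : ideal A) (qP : prime_ideal q).

Lemma quot_chain {V : lmodType A} (N : submodClosed V) n :
  chain qP n (sub0 : submodClosed (quot N)) sub_top <-> chain qP n N sub_top.
Proof.
apply: iff_sym; apply: (chain_transport (f := qproj N) qP).
- by move=> x _; apply: sub_topP.
- by move=> x _; apply: sub_topP.
- by move=> x /qproj0 Nx; apply/sub0P.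
- by move=> x _; apply: sub_topP.
- by move=> x _ /sub0P Nx; apply/qproj0.
move=> y _; have [x <-] := qproj_surj y; exists x; first exact: sub_topP.
by rewrite subrr rpred0.
Qed.

Lemma subquot_chain {V : lmodType A} (Z B : submodClosed V) n : {subset B <= Z} ->
  chain qP n (sub0 : submodClosed (subquot Z B)) sub_top <-> chain qP n B Z.
Proof.
move=> BZ; apply: (iff_trans (quot_chain _ n)).
apply: (chain_transport (f := (\val : submod Z -> V)) qP) => //.
- by move=> x _; apply: sub_topP.
- by move=> x _; apply: valP.
move=> y Zy; have By : y - \val (Sub y Zy : submod Z) \in B by rewrite SubK subrr rpred0.
by exists (Sub y Zy) => //; apply: sub_topP.
Qed.

Hypothesis unitq : forall s : A, s \notin q -> exists t, t * s = 1.

Lemma sat_id {V : lmodType A} (N : submodClosed V) : {subset sat qP N <= N}.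
Proof.
move=> x /satP[s /unitq[t ts] Nsx].
by rewrite -[x]scale1r -ts -scalerA rpredZ.
Qed.

(** Elements outside [q] are units here, so saturation adds nothing and strictness up to saturation
    is plain strictness. *)
Lemma submod_chainP (W : lmodType A) n :
  submod_chain W n <-> chain qP n (sub0 : submodClosed W) sub_top.
Proof.
split=> [[N NS]|].
  suff: chain qP n sub0 (N n) by apply: chain_top => x _; apply: sub_topP.
  have : (n <= n)%N by []. elim: {-2}n => [_|k IH kn] /=.
    by move=> _ /sub0P->; rewrite rpred0.
  have [NNk nNN] := NS _ kn; exists (N k); split=> //; first exact/IH/ltnW.
  by move=> NN; apply: nNN => x /NN/sat_id.
suff H Z : chain qP n sub0 Z -> exists2 N : nat -> submodClosed W,
    (forall i, (i < n)%N -> {subset N i <= N i.+1} /\ ~ {subset N i.+1 <= N i}) &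
    {subset N n <= Z}.
  by case/H => N NS _; exists N.
elim: n Z => [|n IH] Z; first by move=> _; exists (fun=> Z).
case=> Y [/IH[N NS NY] YZ nZY]; exists (fun i => if (i <= n)%N then N i else Z).
  move=> i; rewrite ltnS => ln; rewrite ln; move: ln; rewrite leq_eqVlt => /orP[/eqP->|ln].
    rewrite ltnn; split=> [x /NY/YZ//|ZN].
    by apply: nZY => x /ZN/NY; apply: sub_sat.
  by rewrite ln; apply: NS.
by rewrite ltnn.
Qed.

Lemma module_length_subquot {V : lmodType A} (Z B : submodClosed V) : finlen qP B Z ->
  module_length (subquot Z B) = (len qP B Z)%:Z%:E.
Proof.
move=> fBZ; apply: nat_sup_max.
  by apply/submod_chainP/(subquot_chain _ fBZ.1); case: (lenP fBZ).
by move=> k /submod_chainP/(subquot_chain _ fBZ.1); apply: len_chain.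
Qed.

Lemma finite_length_quot {V : lmodType A} (N : submodClosed V) :
  finite_length (quot N) -> exists n, ~ chain qP n N sub_top.
Proof.
move=> /nat_sup_bounded[n nc]; exists n => cn; apply: nc.
by apply/submod_chainP/quot_chain.
Qed.

End Quotients.

(** * Chains of primes in [A / J] *)

Section QuotientPrimes.
Context {A : comNzRingType} (J : ideal A).

Fact qideal_proof (p : ideal A) :
  prop_submod (fun y : (quot J)^o => exists2 x : A^o, x \in p & y = qproj J x).
Proof.
split=> [|a _ _ [x px ->] [y py ->]].
  by exists 0; rewrite ?rpred0 // (linear0 (qproj J)).
have [b <-] := qproj_surj a.
exists ((b : A) *: x + y); first by rewrite rpredD ?rpredZ.
rewrite linearD /=; congr (_ + _).
by rewrite /GRing.scale /= /qproj !piE.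
Qed.
Definition qideal p := mksub (qideal_proof p).

Lemma qidealP (p : ideal A) (x : A^o) : {subset J <= p} ->
  ((qproj J x : (quot J)^o) \in qideal p) = (x \in p).
Proof.
move=> Jp; apply/mksubP/idP => [[y py xy]|px]; last by exists x.
have /quot_eqP/Jp : (\pi_(quot J) x = \pi_(quot J) y)%qT by [].
by move=> pxy; rewrite -[x](subrK y) rpredD.
Qed.

Lemma prime_qideal (p : ideal A) : {subset J <= p} -> prime_ideal p ->
  prime_ideal (qideal p).
Proof.
move=> Jp [p1 pM]; split.
  have -> : (1 : quot J) = qproj J 1 by rewrite /qproj piE.
  by rewrite qidealP.
move=> a b; have [x <-] := qproj_surj a; have [y <-] := qproj_surj b.
have -> : qproj J x * qproj J y = qproj J ((x : A) * y) by rewrite /qproj !piE.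
by rewrite !qidealP //; apply: pM.
Qed.

Lemma qideal_mono (p p1 : ideal A) : {subset J <= p} -> {subset J <= p1} ->
  {subset qideal p <= qideal p1} <-> {subset p <= p1}.
Proof.
move=> Jp Jp1; split=> pp x.
  by rewrite -(qidealP _ Jp) -(qidealP _ Jp1); apply: pp.
have [y <-] := qproj_surj x; rewrite !qidealP //; apply: pp.
Qed.

Lemma prime_chain_quot (E : ideal A) n p : prime_chain_over E n p -> {subset J <= p} ->
  prime_chain (quot J) n.
Proof.
move=> c Jp.
suff [P [PP JP PS]] : exists P : nat -> ideal A,
    [/\ forall i, (i <= n)%N -> prime_ideal (P i),
      forall i, (i <= n)%N -> {subset J <= P i} &
      forall i, (i < n)%N -> {subset P i <= P i.+1} /\ ~ {subset P i.+1 <= P i}].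
  exists (fun i => qideal (P i)); split=> i ni; first by apply: prime_qideal; auto.
  have JPi := JP i (ltnW ni); have JPSi := JP i.+1 ni.
  by have [PPi nPPi] := PS i ni; split; rewrite qideal_mono.
suff [P [P0 PP PS]] : exists P : nat -> ideal A,
    [/\ P 0%N = p, forall i, (i <= n)%N -> prime_ideal (P i) &
      forall i, (i < n)%N -> {subset P i <= P i.+1} /\ ~ {subset P i.+1 <= P i}].
  exists P; split=> //; elim=> [_|i IH ni]; first by rewrite P0.
  by move=> x /(IH (ltnW ni)); apply: (PS i ni).1.
elim: n p c {Jp} => [|n IH] p [pP].
  by move=> _; exists (fun=> p); split.
case=> p1 [pp1 np1p /IH[P [P0 PP PS]]].
exists (fun i => if i is i'.+1 then P i' else p); split=> // -[|i] //=.
- exact: PP.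
- by rewrite P0.
- exact: PS.
Qed.

End QuotientPrimes.

(** * The determinant trick *)

Section Determinant.
Context {A : comNzRingType}.
Implicit Types (J : ideal A).

Lemma prod_congr J (T : finType) (F G : T -> A) :
  (forall i, (F i - G i : A^o) \in J) -> (\prod_i F i - \prod_i G i : A^o) \in J.
Proof.
move=> FG; elim/big_rec2: _ => [|i x y _ Jxy]; first by rewrite subrr rpred0.
have -> : F i * y - G i * x = y * (F i - G i) + G i * (y - x) by ring.
by apply: rpredD; apply: idealM.
Qed.

Lemma det_congr J n (S T : 'M[A]_n) :
  (forall i j, (S i j - T i j : A^o) \in J) -> (\det S - \det T : A^o) \in J.
Proof.
move=> ST; rewrite /determinant -sumrB; apply: rpred_sum => s _.
by rewrite -mulrBr; apply: idealM; apply: prod_congr.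
Qed.

(** Cramer's rule: multiply the system of relations by the adjugate of [T]. *)
Lemma det_kills {M : lmodType A} n (T : 'M[A]_n) (g : 'I_n -> M) :
  (forall i, \sum_j T i j *: g j = 0) -> forall i, \det T *: g i = 0.
Proof.
move=> Tg i.
have adjT j : \sum_k \adj T i k * T k j = \det T *+ (i == j).
  by have := congr1 (fun N : 'M_n => N i j) (mul_adj_mx T); rewrite !mxE.
transitivity (\sum_j (\det T *+ (i == j)) *: g j).
  rewrite (bigD1 i) //= eqxx big1 ?addr0 // => j ji.
  by rewrite eq_sym (negPf ji) scale0r.
rewrite (eq_bigr (fun j => \sum_k (\adj T i k * T k j) *: g j)) => [|j _]; last first.
  by rewrite -adjT scaler_suml.
rewrite exchange_big big1 // => k _ /=.
transitivity (\adj T i k *: \sum_j T k j *: g j); last by rewrite Tg scaler0.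
by rewrite scaler_sumr; apply: eq_bigr => j _; rewrite scalerA.
Qed.

Lemma finite_generators {M : lmodType A} : finitely_generated M ->
  exists n (g : 'I_n -> M), forall x, exists c : 'I_n -> A, x = \sum_j c j *: g j.
Proof.
move=> /finitely_generated_span[s sM]; exists (size s), (fun i => s`_i) => x.
move: (sM x); elim: s x {sM} => [|y s IH] x /=.
  by move=> ->; exists (fun=> 0); rewrite big_ord0.
case=> a [z [/IH[c ->] ->]].
exists (fun i => if unlift ord0 i is Some k then c k else a).
rewrite big_ord_recl unlift_none /=; congr (_ + _).
by apply: eq_bigr => i _; rewrite liftK.
Qed.

Lemma ideal_smul_sum (I : ideal A) (M : lmodType A) n (g : 'I_n -> M) :
    (forall x, exists c : 'I_n -> A, x = \sum_j c j *: g j) ->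
  forall x, x \in ideal_smul I M ->
  exists2 b : 'I_n -> A, (forall j, (b j : A^o) \in I) & x = \sum_j b j *: g j.
Proof.
move=> gM x.
have T_proof : prop_submod (fun x : M =>
    exists2 b : 'I_n -> A, (forall j, (b j : A^o) \in I) & x = \sum_j b j *: g j).
  split=> [|a _ _ [b Ib ->] [c Ic ->]].
    exists (fun=> 0) => [j|]; first by rewrite rpred0.
    by rewrite big1 // => j _; rewrite scale0r.
  exists (fun j => a * b j + c j) => [j|]; first by apply: rpredD => //; apply: idealM.
  by rewrite scaler_sumr -big_split; apply: eq_bigr => j _; rewrite scalerDl scalerA.
move=> Ix; apply/(mksubP T_proof); apply: submod_gen_min Ix => _ [a [y [Ia ->]]].
have [c ->] := gM y; apply/mksubP; exists (fun j => a * c j) => [j|].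
  by rewrite mulrC; apply: idealM.
by rewrite scaler_sumr; apply: eq_bigr => j _; rewrite scalerA.
Qed.

(* If [a^k M <= a^(k+1) M + I M], write this on generators as [T g = 0] with
   [T = a^k (1 - a R) - B]; then [det T] kills [M], and modulo [I] it is
   [a^(k n) det (1 - a R)], where [det (1 - a R) = 1] modulo [a]. *)
Lemma det_supported (q : ideal A) (qP : prime_ideal q) (I : ideal A)
    (M : lmodType A) (a : A) k :
    finitely_generated M -> a \in q ->
    (forall x : M, exists y z, [/\ z \in ideal_smul I M & a ^+ k *: x = a ^+ k.+1 *: y + z]) ->
  exists2 s : A, s \notin q &
    exists l, (s * a ^+ l : A^o) \in add I (colon sub0 (sub_top : submodClosed M)).
Proof.
move=> /finite_generators[n [g gM]] qa aM.
have /choice[r rP] : forall i, exists rb : ('I_n -> A) * ('I_n -> A),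
    (forall j, (rb.2 j : A^o) \in I) /\
    a ^+ k *: g i = \sum_j (a ^+ k.+1 * rb.1 j + rb.2 j) *: g j.
  move=> i; have [y [z [/(ideal_smul_sum gM)[b Ib ->] ->]]] := aM (g i).
  have [c ->] := gM y; exists (c, b); split=> //=.
  by rewrite scaler_sumr -big_split; apply: eq_bigr => j _; rewrite scalerDl scalerA.
pose N : 'M[A]_n := 1%:M - a *: \matrix_(i, j) (r i).1 j.
pose T : 'M[A]_n := a ^+ k *: N - \matrix_(i, j) (r i).2 j.
have killT : (\det T : A^o) \in colon sub0 (sub_top : submodClosed M).
  apply/colonP => x _; have [c ->] := gM x; apply/sub0P.
  rewrite scaler_sumr big1 // => j _; rewrite scalerA mulrC -scalerA.
  rewrite (@det_kills _ _ _ g) ?scaler0 // => i.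
  transitivity (a ^+ k *: g i - \sum_j (a ^+ k.+1 * (r i).1 j + (r i).2 j) *: g j); last first.
    by case: (rP i) => _ <-; rewrite subrr.
  have -> : a ^+ k *: g i = \sum_j (a ^+ k * (i == j)%:R) *: g j.
    rewrite (bigD1 i) //= eqxx mulr1 big1 ?addr0 // => l li.
    by rewrite eq_sym (negPf li) mulr0 scale0r.
  rewrite -sumrB; apply: eq_bigr => l _; rewrite -scalerBl !mxE; congr (_ *: _).
  by rewrite exprS; ring.
exists (\det N).
  apply/negP => qN; case/negP: (prime1 qP).
  have q1N : (\det (1%:M : 'M[A]_n) - \det N : A^o) \in q.
    apply: det_congr => i j.
    have -> : 1%:M i j - N i j = (r i).1 j * a by rewrite !mxE; ring.
    exact: idealM.
  by rewrite -(det1 A n) -[\det 1%:M](subrK (\det N)); apply: rpredD.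
exists (k * n)%N; apply/addP; exists (\det N * a ^+ (k * n) - \det T), (\det T).
split=> //; last by rewrite subrK.
rewrite mulrC exprM -detZ; apply: det_congr => i j.
have -> : (a ^+ k *: N) i j - T i j = (r i).2 j by rewrite !mxE; ring.
by case: (rP i).
Qed.

End Determinant.

(** * Local rings: units outside [mm], and chains of primes ending at [mm] *)

Section Local.
Context {A : comNzRingType} (mm : ideal A).
Hypotheses (noeA : noetherian_ring A) (locA : local_ring mm).

Lemma local_unit s : s \notin mm -> exists t, t * s = 1.
Proof.
move=> smm; apply: contrapT => ns.
pose J := img (scale_by (s : A)) (sub_top : ideal A).
have J1 : (1 : A^o) \notin J.
  by apply/negP => /imgP[t _ tE]; apply: ns; exists t; rewrite mulrC; apply: esym.
have [|X [JX X1] Xmax] := acc_max (P := fun X : submodClosed A^o =>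
  {subset J <= X} /\ (1 : A^o) \notin X) (X0 := J) (acc_ring noeA); first by split.
have maxX : maximal_ideal X.
  split=> // Y Y1 XY x; apply/idP/idP; last exact: XY.
  by apply: Xmax => //; split=> // y /JX/XY.
case/negP: smm; rewrite -(locA.2 X maxX); apply: JX.
by apply/imgP; exists 1; [apply: sub_topP | apply: (esym (mulr1 s))].
Qed.

Lemma local_prime : prime_ideal mm.
Proof.
have [mm1 _] := locA.1; split=> // a b mab.
case: (boolP (a \in mm)) => [|/local_unit[t ta]]; [by left | right].
by rewrite -[b]mul1r -ta -mulrA; apply: idealM.
Qed.

Lemma prime_sub_local (p : ideal A) : prime_ideal p -> {subset p <= mm}.
Proof.
move=> [p1 _] a pa; apply: contrapT => /negP/local_unit[t ta].
by case/negP: p1; rewrite -ta; apply: idealM.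
Qed.

(** The top prime is replaced by [mm], which contains every prime; the chain is then rebuilt
    downwards, whence the index [n - k]. *)
Lemma prime_chain_to_local n : prime_chain A n -> exists p, prime_chain_over mm n p.
Proof.
case=> P [PP PS].
suff H k : (k <= n)%N ->
    exists2 p : ideal A, {subset P (n - k)%N <= p} & prime_chain_over mm k p.
  by have [p _ c] := H n (leqnn n); exists p.
elim: k => [_|k IH kn].
  exists mm; last by split=> //; apply: local_prime.
  by apply: prime_sub_local; apply: PP; rewrite leq_subr.
have [p Pp c] := IH (ltnW kn); exists (P (n - k.+1)%N) => //.
split; first by apply: PP; rewrite leq_subr.
have nk : (n - k.+1).+1 = (n - k)%N by rewrite subnSK.
have [|PPn nPP] := PS (n - k.+1)%N; first by rewrite ltn_subrL (leq_trans _ kn).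
rewrite nk in PPn nPP; exists p; split=> // [x /PPn/Pp//|pP].
by apply: nPP => x /Pp/pP.
Qed.

End Local.

Theorem theorem1p2 (A : comNzRingType) (mm : ideal A)
    (M : lmodType A) (m : nat) (u : 'I_m -> A) :
  regular_local_ring mm ->
  finitely_generated M ->
  (forall i, u i \in mm) ->
  let I := ideal_gen u in
  finite_length (quot (ideal_smul I M)) ->
  (module_dim M + krull_dim (quot I) < krull_dim A)%E ->
  koszul_char u M = 0%E /\ (module_dim M < m%:Z%:E)%E.
Proof.
move=> [locA noeA [d [_ [dimA _]]]] fgM umm I flM dimMI.
have mmP := local_prime noeA locA; have unitA := local_unit noeA locA.
have gensI : {subset I <= first_gens u m}.
  apply: submod_gen_min => _ [k _ <-]; apply: submod_genP; exists k => //.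
have dimM : (module_dim M < m%:Z%:E)%E.
  have [e ce dem] : exists2 e, prime_chain (quot I) e & (d <= e + m)%N.
    have [p cp] := prime_chain_to_local noeA locA (nat_sup_attained dimA).
    have Imm : {subset I <= mm} by apply: submod_gen_min => _ [k _ <-].
    (* If [d < m], then [e = 0] is enough: [mm] contains [I], so [A / I] has a prime. Otherwise each
       of the [m] generators costs one step of a chain of [d] steps. *)
    have [md|dm] := leqP m d; last first.
      exists 0%N; last by rewrite add0n ltnW.
      by apply: (prime_chain_quot (E := mm) (p := mm)) => //; split.
    have [||p' [_ up' cp']] :=
        prime_chain_drops noeA (E := mm) (n := (d - m)%N) (s := codom u) (p := p).
    - by rewrite size_codom card_ord subnKC.
    - by move=> _ /codomP[i ->].
    exists (d - m)%N; last by rewrite subnK.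
    apply: (prime_chain_quot cp'); apply: submod_gen_min => _ [k _ <-].
    by apply: up'; apply: codom_f.
  have dI := nat_sup_ge ce.
  have : (module_dim M + e%:Z%:E < d%:Z%:E)%E.
    by rewrite -dimA; apply: le_lt_trans dimMI; apply: leeD2l.
  (* The value [-oo], taken by the zero module, satisfies the bound trivially, and [+oo] contradicts
     the dimension hypothesis. *)
  case: (module_dim M) => [z||] //.
  rewrite -EFinD !lte_fin; move: dem; lia.
split=> //.
have topM0 : {subset sub0 <= (sub_top : submodClosed M)} by move=> x _; apply: sub_topP.
have supp : supported u mm m sub0 (sub_top : submodClosed M).
  move=> a qa; have [n nc] := finite_length_quot mmP unitA flM.
  (* The submodules [a^k M + I M] decrease with [k]. Were every inclusion strict, they would give
     arbitrarily long chains above [I M], against the finite length of [M / IM]; one equality is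
     what [det_supported] asks for. *)
  pose X k := add (img (scale_by (a ^+ k)) sub_top) (ideal_smul I M).
  have [k Xk] : exists k, {subset X k <= X k.+1}.
    apply: contrapT => /forallNP nX; apply: nc.
    suff: chain mmP n (X n) sub_top by apply: chain_bot; apply: sub_addr.
    elim: n => [|n IH]; first by move=> x _; apply: sub_topP.
    rewrite -add1n; apply: chain_cat IH; exists (X n.+1); split=> //.
      apply: add_min; last exact: sub_addr.
      move=> _ /imgP[x _ ->]; apply: sub_addl; apply/imgP.
      exists (a *: x); first exact: sub_topP.
      have E : a ^+ n.+1 *: x = a ^+ n *: (a *: x) by rewrite scalerA exprSr.
      exact: E.
    by move=> Xn; apply: (nX n) => x /Xn; apply: sat_id.
  have [|s smm [l sl]] := det_supported mmP (I := I) (k := k) fgM qa.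
    move=> x; have /Xk/addP[_ [z [/imgP[y _ ->] Iz xE]]] : a ^+ k *: x \in X k.
      by apply: sub_addl; apply/imgP; exists x => //; apply: sub_topP.
    by exists y, z.
  exists s => //; exists l; apply: add_min sl => [x /gensI|]; first exact: sub_addl.
  exact: sub_addr.
have [finK chi0] := kchi_vanish noeA (acc_module noeA fgM) mmP (leqnn m) topM0 supp.
(* A chain of [m] strict steps above the annihilator would give [dim M >= m], against part (2). *)
have {}chi0 : kchi u mmP m sub_top (sub0 : submodClosed M) = 0.
  apply: chi0 => p colp cp; have /nat_sup_ge : prime_chain (quot (ann M)) m.
    apply: (prime_chain_quot cp) => a /asboolP aM; apply: colp.
    by apply/colonP => x _; apply/sub0P.
  by rewrite leNgt => /negP[].
(* With all [m] generators, and the pair of the zero submodule and [M], the cycles and boundaries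
   taken in place are those defining [koszul_homology]. *)
have belowm : below m = [set: 'I_m]%SET by apply/finset.setP => k; rewrite !finset.inE ltn_ord.
have degP i (x : @koszul A m M) : reflect (koszul_deg i x) (x \in kpart m 0 i sub_top).
  apply: (iffP (kpartP _ _ _ _ _)) => [[_ x0] S /eqP iS|dx].
    by apply: x0; rewrite addn0 (negPf iS).
  split=> S; first exact: sub_topP.
  by rewrite belowm finset.subsetT andbT addn0 => /eqP; apply: dx.
have kval0 (x : @koszul A m M) : (x \in kval (sub0 : submodClosed M)) = (x == 0).
  apply/kvalP/eqP => [x0|-> S]; last by rewrite ffunE rpred0.
  by apply/ffunP => S; rewrite ffunE; apply/sub0P.
have ZE i : koszul_cycles u M i =i kcycles u m 0 i sub_top sub0.
  move=> x; apply/asboolP/kcyclesP => -[/degP dx dx0]; split=> //.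
    by rewrite kval0 dx0.
  by apply/eqP; rewrite -kval0.
have BE i : koszul_boundaries u M i =i kbounds u m 0 i sub_top sub0.
  move=> x; apply/asboolP/kboundsP => [[y /degP dy ->]|[y [w [/degP dy /kpart_kval]]]].
    by exists y, 0; rewrite rpred0 addr0.
  by rewrite kval0 => /eqP-> ->; exists y; rewrite ?addr0.
have lenE i : module_length (koszul_homology u M i) =
    (klen u mmP m 0 i sub_top (sub0 : submodClosed M))%:Z%:E.
  have [fE lE] := len_eq mmP (BE i) (ZE i).
  by rewrite (module_length_subquot unitA (qP := mmP)) ?lE //; apply/fE.
suff -> : koszul_char u M = (kchi u mmP m sub_top (sub0 : submodClosed M))%:E by rewrite chi0.
by rewrite /koszul_char /kchi -sumEFin; apply: eq_bigr => i _; rewrite lenE.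
Qed.
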